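(* Let $(X,d,\mu)$ be a doubling metric measure space. For all $\alpha,\beta\in(0,\infty)$ and $p,q\in(0,\infty)$, the tent space (quasi-)norms $\|\cdot\|_{T^{p,q,\alpha}(X)}$ and $\|\cdot\|_{T^{p,q,\beta}(X)}$ are equivalent.
   Context: A metric measure space $(X,d,\mu)$ is a metric space $(X,d)$ with a Borel measure $\mu$. Write $B(x,r)=\{y\in X: d(x,y)<r\}$ and $V(x,r)=\mu(B(x,r))$; it is assumed throughout that $0<V(x,r)<\infty$ for all $x\in X$, $r>0$. $X$ is *doubling* if there is $C>0$ with $V(x,2r)\le C\,V(x,r)$ for all $x\in X$, $r>0$. Let $X^+:=X\times(0,\infty)$ with the product topology and the measure $d\mu(y)\,dt/t$. For $x\in X$, $\alpha>0$ the cone is $\Gamma^\alpha(x):=\{(y,t)\in X^+: d(x,y)<\alpha t\}$. For $q\in(0,\infty)$ and measurable $f:X^+\to\mathbb{C}$, $$\mathcal{A}_q^\alpha(f)(x):=\left(\iint_{\Gamma^\alpha(x)}|f(y,t)|^q\,\frac{d\mu(y)}{V(y,\alpha t)}\,\frac{dt}{t}\right)^{1/q},$$ and for $p\in(0,\infty)$, $\|f\|_{T^{p,q,\alpha}(X)}:=\|\mathcal{A}_q^\alpha(f)\|_{L^p(X)}$. $T^{p,q,\alpha}(X)$ is the space of measurable $f$ (modulo a.e. equality) for which this is finite. Equivalence of the (quasi-)norms means that each is bounded by a constant multiple of the other, with constants independent of the function. *)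

(* Defs.v *)
From HB Require Import structures.
From mathcomp Require Import all_boot all_order all_algebra complex.
From mathcomp Require Import all_classical all_reals all_analysis.

Set Implicit Arguments.
Unset Strict Implicit.
Unset Printing Implicit Defensive.

Import Order.TTheory GRing.Theory Num.Theory numFieldNormedType.Exports.

Local Open Scope classical_set_scope.
Local Open Scope ring_scope.
Local Open Scope ereal_scope.

(* The library's measurable spaces are pointed, so a metric space carrying a
   measure is taken to be nonempty. *)
#[short(type="pmetricType")]
HB.structure Definition PointedMetric (K : numDomainType) :=
  {M of Metric K M & Pointed M}.

Notation borel T := (g_sigma_algebraType (@open T)).

Section TentSpaces.
Context (R : realType) (X : pmetricType R).
Implicit Types (mu : {measure set (borel X) -> \bar R}) (alpha p q : R).

Definition volume mu (x : X) (r : R) : \bar R := mu (ball x r).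

Definition balls_nondegenerate mu : Prop :=
  forall (x : X) (r : R), (0 < r)%R -> 0 < volume mu x r < +oo.

Definition doubling mu : Prop :=
  exists2 C : R, (0 < C)%R &
    forall (x : X) (r : R), (0 < r)%R ->
      volume mu x (2 * r)%R <= C%:E * volume mu x r.

(* X^+ is represented as a subset of X * R: functions on X^+ are functions on
   X * R of which only the values on this subset matter. *)
Definition upper_half : set (X * R) := [set z | (0 < z.2)%R].

Definition cone alpha (x : X) : set (X * R) :=
  upper_half `&` [set z | (mdist x z.1 < alpha * z.2)%R].

(* Borel measurability for the product sigma-algebra of Borel(X) and Borel(R)
   (X is separable when it is doubling, so that this is also the Borel
   sigma-algebra of the product topology).  The regular module R[i]^o is R[i]
   with its usual topology. *)
Definition measurable_on_upper_half (f : X * R -> R[i]) : Prop :=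
  measurable_fun (upper_half : set (borel X * R))
    (f : borel X * R -> borel (R[i]^o)%R).

(* The factor (z.2)^-1 is the density of dt/t with respect to dt; volumes of
   balls of positive radius are finite by nondegeneracy, so taking fine is
   harmless. *)
Definition area_functional mu q alpha (f : X * R -> R[i]) (x : X) : \bar R :=
  (\int[mu \x @lebesgue_measure R]_(z in cone alpha x)
     (ComplexField.Normc.normc (f z) `^ q
        / fine (volume mu z.1 (alpha * z.2)) / z.2)%:E) `^ q^-1.

(* Takes the value +oo when f is not in the tent space. *)
Definition tent_norm mu p q alpha (f : X * R -> R[i]) : \bar R :=
  'N[mu]_p%:E[area_functional mu q alpha f].

End TentSpaces.

(* Equivalence on D of two [0, +oo]-valued (quasi-)norms; in particular they
   are finite for the same elements of D. *)
Definition equivalent_norms (R : realType) (T : Type) (D : set T)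
    (N1 N2 : T -> \bar R) : Prop :=
  exists C1 C2 : R, [/\ (0 < C1)%R, (0 < C2)%R &
    forall f, D f -> N1 f <= C1%:E * N2 f /\ N2 f <= C2%:E * N1 f].

(* Main.v *)
(** The idea.  With [s = p / q] and [G = |f|^q / (V t)], put
    [A_r(x) = \int_(cone r x) G] and [I_k = \int A_(5^k a)^s dmu]; by doubling it
    suffices to bound [I_k] by a multiple of [I_0].  Let [A_r^(>=t)] be the part of
    [A_r] coming from heights at least [t].  It has two features.
    - Telescoping in [t] (a discrete form of
      [A^s = s \int (A^(>=t))^(s-1) dA]) linearises [A^s].
    - Moving the vertex by less than a multiple of [t] changes [A_r^(>=t)] by no
      more than an enlargement of the aperture does.
    After linearising, Tonelli turns the integral over [x] into integrals over balls
    [B(y, r t)] of powers [s - 1] of [A^(>=t)], and the second feature with doubling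
    replaces these balls by [B(y, a t)].  For [s >= 1] this gives
    [I_k <= c E^k \int A_a (A_(5^(k+1) a))^(s-1)]; for [s < 1] it gives
    [\int A_(5^k a) (A_(5^(k+1) a))^(s-1) <= c E^k I_0].  By Young's inequality, in
    both cases [I_k <= e I_(k+1) + K(e) E^k I_0] for every [e > 0].  For truncated
    [f], [I_k] grows at most geometrically, at a rate independent of [f], so a small
    [e] makes this recurrence absorb the first term, with a constant independent of
    [f].  Neither a maximal function nor a covering lemma is needed. *)

Require Import Defs.
From HB Require Import structures.
From mathcomp Require Import all_boot all_order all_algebra complex.
From mathcomp Require Import all_classical all_reals all_analysis.
From mathcomp Require Import measurable_realfun lra ring.
Set Implicit Arguments.
Unset Strict Implicit.
Unset Printing Implicit Defensive.

Import Order.TTheory GRing.Theory Num.Theory numFieldNormedType.Exports.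

Local Open Scope classical_set_scope.
Local Open Scope ring_scope.

(** * Inequalities for powers *)

Section PowerInequalities.
Context {R : realType}.
Implicit Types (a b u v x r s e : R).

Lemma onemX_le x n : 0 <= x <= 1 -> 1 - x ^+ n <= n%:R * (1 - x).
Proof.
move=> /andP[x0 x1]; elim: n => [|n IHn]; first by rewrite expr0 subrr mul0r.
have -> : 1 - x ^+ n.+1 = 1 - x + x * (1 - x ^+ n) by rewrite exprS; ring.
rewrite -natr1 mulrDl mul1r addrC lerD2r (le_trans _ IHn)//.
by rewrite ler_piMl// subr_ge0 exprn_ile1.
Qed.

(** For an integer [n > r] and [x] in [[0, 1]] one has [x^n <= x^r], so Bernoulli's inequality
    [onemX_le] applies with constant [n]. *)
Lemma onem_powR_le r : 0 < r ->
  exists2 C, 0 < C & forall x, 0 <= x <= 1 -> 1 - x `^ r <= C * (1 - x).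
Proof.
move=> r0; pose n := (Num.bound r).
have rn : r < n%:R by apply: archi_boundP; exact: ltW.
exists n%:R => [|x /andP[x0 x1]]; first exact: lt_trans rn.
(* Comparing powers with different exponents requires a positive base; at [0] the claim is
   [1 <= n]. *)
have [->|xN0] := eqVneq x 0.
  rewrite powR0 ?gt_eqF// subr0 mulr1 -[1]/(1%:R) ler_nat lt0n.
  by rewrite -(@pnatr_eq0 R) gt_eqF// (lt_trans r0).
rewrite (le_trans _ (onemX_le n _)) ?x0//.
rewrite lerD2l lerN2 -powR_mulrn// ger_powR ?(ltW rn)// x1 andbT.
by rewrite lt_neqAle eq_sym xN0.
Qed.

(** By homogeneity, dividing by [u^s] reduces this to [onem_powR_le] at [x = b / u]. *)
Lemma powR_sub_le s : 1 <= s -> exists2 C, 0 < C &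
  forall b u, 0 <= b <= u -> u `^ s - b `^ s <= C * ((u - b) * u `^ (s - 1)).
Proof.
move=> s1; have s0 : 0 < s by rewrite (lt_le_trans _ s1).
have [C C0 HC] := onem_powR_le s0; exists C => // b u /andP[b0 bu].
have [u0|u0] := eqVneq u 0.
  have -> : b = 0 by apply/eqP; rewrite eq_le b0 -u0 bu.
  by rewrite u0 !subrr mul0r mulr0.
have up : 0 < u by rewrite lt_neqAle eq_sym u0 (le_trans b0).
have xu : u * (b / u) = b by rewrite mulrCA divff ?mulr1.
have x0 : 0 <= b / u by rewrite divr_ge0// ltW.
have x1 : b / u <= 1 by rewrite ler_pdivrMr ?mul1r.
have := HC (b / u); rewrite x0 x1 => /(_ isT) HC1.
have -> : u `^ s - b `^ s = u `^ s * (1 - (b / u) `^ s).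
  by rewrite -{1}xu powRM ?(ltW up)// mulrBr mulr1.
have -> : (u - b) * u `^ (s - 1) = u `^ s * (1 - b / u).
  by rewrite -(mulr_powRB1 (ltW up) s0) -{1}xu; ring.
by rewrite mulrCA ler_wpM2l// powR_ge0.
Qed.

(** The concave counterpart of [powR_sub_le]: apply [onem_powR_le] with exponent [1 / s] at
    [x = (b / u)^s], so that [x^(1/s) = b / u]. *)
Lemma sub_mul_powR_le s : 0 < s -> s <= 1 -> exists2 C, 0 < C &
  forall b u, 0 <= b <= u -> 0 < u ->
    (u - b) / u `^ (1 - s) <= C * (u `^ s - b `^ s).
Proof.
move=> s0 s1; have [C C0 HC] := @onem_powR_le s^-1 (ltac:(by rewrite invr_gt0)).
exists C => // b u /andP[b0 bu] up.
have u0 : u != 0 by rewrite gt_eqF.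
have xu : u * (b / u) = b by rewrite mulrCA divff ?mulr1.
have x0 : 0 <= b / u by rewrite divr_ge0// ltW.
have x1 : b / u <= 1 by rewrite ler_pdivrMr ?mul1r.
have y1 : (b / u) `^ s <= 1.
  have := ge0_ler_powR (ltW s0) x0 ler01 x1; by rewrite powR1.
have := HC ((b / u) `^ s); rewrite powR_ge0 y1 -powRrM divff ?gt_eqF//.
rewrite powRr1// => /(_ isT) HC1.
have us : u `^ s != 0 by rewrite gt_eqF// powR_gt0.
have -> : u `^ s - b `^ s = u `^ s * (1 - (b / u) `^ s).
  by rewrite -{1}xu powRM ?(ltW up)// mulrBr mulr1.
have -> : (u - b) / u `^ (1 - s) = u `^ s * (1 - b / u).
  rewrite powRB ?u0 ?implybT// powRr1 ?(ltW up)// -{1}xu; field.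
  by rewrite us u0.
by rewrite mulrCA ler_wpM2l// powR_ge0.
Qed.

(** One term on the right suffices in each case: the first if [a <= e b], and otherwise the second,
    because then [b < a / e]. *)
Lemma mul_powR_young s e a b : 1 <= s -> 0 < e -> 0 <= a -> 0 <= b ->
  a * b `^ (s - 1) <= e * b `^ s + e `^ (1 - s) * a `^ s.
Proof.
move=> s1 e0 a0 b0; have s0 : 0 < s by rewrite (lt_le_trans _ s1).
have [ab|ab] := leP a (e * b).
  rewrite (@le_trans _ _ (e * b `^ s))//; last first.
    by rewrite lerDl mulr_ge0 ?powR_ge0.
  by rewrite -(mulr_powRB1 b0 s0) mulrA ler_wpM2r ?powR_ge0.
rewrite (@le_trans _ _ (e `^ (1 - s) * a `^ s))//; last first.
  by rewrite lerDr mulr_ge0 ?powR_ge0// ltW.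
rewrite -(mulr_powRB1 a0 s0) mulrCA ler_wpM2l//.
have -> : 1 - s = - (s - 1) by rewrite opprB.
rewrite powRN ler_pdivlMl ?powR_gt0// -powRM ?(ltW e0)//.
by rewrite ge0_ler_powR ?nnegrE ?subr_ge0 ?mulr_ge0// ltW.
Qed.

Local Open Scope ereal_scope.

(** Split at [u = d v] with [d^s = e]. Below, [u^s <= e v^s]; above, [u^(s-1) <= (d v)^(s-1)],
    whence [K = d^(s-1)]. *)
Lemma powR_young_inve s e : (0 < s)%R -> (s < 1)%R -> (0 < e)%R ->
  exists2 K, (0 < K)%R & forall u v, (0 <= u <= v)%R ->
    (u `^ s)%:E <= (e * v `^ s)%:E + K%:E * (u%:E * ((v `^ (1 - s))%:E)^-1).
Proof.
move=> s0 s1 e0; pose d := (e `^ s^-1)%R.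
have d0 : (0 < d)%R by rewrite powR_gt0.
exists (d `^ (1 - s))^-1%R => [|u v /andP[u0 uv]].
  by rewrite invr_gt0 powR_gt0.
have [uv'|uv'] := leP u (d * v)%R.
  apply: (@le_trans _ _ (e * v `^ s)%:E); last first.
    rewrite leeDl// mule_ge0// ?lee_fin ?invr_ge0 ?powR_ge0//.
    by rewrite mule_ge0// ?inve_ge0 ?lee_fin ?powR_ge0.
  have -> : e = (d `^ s)%R.
    by rewrite -powRrM mulVf ?gt_eqF// powRr1// ltW.
  have v0 : (0 <= v)%R by rewrite (le_trans u0).
  rewrite lee_fin -powRM ?(ltW d0)//.
  by rewrite ge0_ler_powR ?nnegrE ?(ltW s0)// (le_trans u0).
have v0 : (0 < v)%R.
  rewrite lt_neqAle (le_trans u0 uv) andbT; apply/eqP => v0.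
  by move: uv' uv; rewrite -v0 mulr0 => /lt_le_trans/[apply]; rewrite ltxx.
have up : (0 < u)%R by rewrite (lt_trans _ uv')// mulr_gt0.
apply: (@le_trans _ _
  ((d `^ (1 - s))^-1%:E * (u%:E * ((v `^ (1 - s))%:E)^-1))); last first.
  by rewrite leeDr// lee_fin mulr_ge0 ?powR_ge0 ?(ltW e0).
rewrite inver gt_eqF ?powR_gt0// -!EFinM lee_fin mulrCA -invfM -powRM ?(ltW d0) ?(ltW v0)//.
rewrite ler_pdivlMr ?powR_gt0 ?mulr_gt0//.
have us : (u `^ s * u `^ (1 - s) = u)%R.
  by rewrite -powRD ?(gt_eqF up) ?implybT// addrC subrK powRr1// ltW.
rewrite -[leRHS]us ler_wpM2l ?powR_ge0//.
by rewrite ge0_ler_powR ?nnegrE ?subr_ge0 ?(ltW s1) ?(ltW uv') ?mulr_ge0 ?(ltW d0) ?(ltW v0).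
Qed.

Let tail n (a : nat -> R) j := (\sum_(j <= i < n) a i)%R.

(* Discrete form of [A^s = s \int (A^(>=t))^(s-1) dA]. *)
Lemma powR_sum_le s : (1 <= s)%R -> exists2 C, (0 < C)%R &
  forall n (a : nat -> R), (forall i, 0 <= a i)%R ->
    ((\sum_(0 <= i < n) a i) `^ s <=
     C * \sum_(0 <= j < n) a j * (\sum_(j <= i < n) a i) `^ (s - 1))%R.
Proof.
move=> s1; have s0 : (0 < s)%R by rewrite (lt_le_trans _ s1).
have [C C0 HC] := powR_sub_le s1; exists C => // n a a0.
(* The full sum to the power [s] is the sum of the differences of [tail_j^s], and [powR_sub_le]
   bounds each of them with [u = tail_j], [b = tail_(j+1)]. *)
have := telescope_sumr (fun j => - tail n a j `^ s)%R (leq0n n).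
have tn : tail n a n = 0%R by rewrite /tail big_geq.
rewrite tn powR0 ?gt_eqF// oppr0 add0r opprK => <-.
rewrite mulr_sumr ler_sum_nat// => j /andP[_ jn].
have tS : tail n a j = (a j + tail n a j.+1)%R by rewrite /tail big_ltn.
rewrite opprK addrC (le_trans (HC _ _ _))//.
  by rewrite tS lerDr a0 sumr_ge0.
by rewrite {1}tS addrK.
Qed.

(* The extended inverse, with [0^-1 = +oo], makes [(A^(>=t))^(s-1)] decreasing in
   [A^(>=t)] also at [0]. *)
Lemma sum_mul_inve_le s : (0 < s)%R -> (s < 1)%R -> exists2 C, (0 < C)%R &
  forall n (a : nat -> R), (forall i, 0 <= a i)%R ->
    \sum_(0 <= j < n) (a j)%:E * (((\sum_(j <= i < n) a i) `^ (1 - s))%:E)^-1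
    <= (C * (\sum_(0 <= i < n) a i) `^ s)%:E.
Proof.
move=> s0 s1.
have [C C0 HC] := sub_mul_powR_le s0 (ltW s1); exists C => // n a a0.
have := telescope_sumr (fun j => - tail n a j `^ s)%R (leq0n n).
have tn : tail n a n = 0%R by rewrite /tail big_geq.
rewrite tn powR0 ?gt_eqF// oppr0 add0r opprK => <-.
rewrite mulr_sumr -sumEFin !big_mkord; apply: lee_sum => -[j jn] _ /=.
have tS : tail n a j = (a j + tail n a j.+1)%R by rewrite /tail big_ltn.
have t0 k : (0 <= tail n a k)%R by rewrite sumr_ge0.
have tj : (tail n a j.+1 <= tail n a j)%R by rewrite tS lerDr.
rewrite -/(tail n a j) opprK [(- _ + _)%R]addrC.
(* A vanishing tail has inverse [+oo], but then [a j = 0] and the product is [0]. *)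
have [tj0|tj0] := eqVneq (tail n a j) 0%R.
  have -> : a j = 0%R.
    by apply/eqP; rewrite eq_le a0 -tj0 tS lerDl t0.
  rewrite mul0e lee_fin mulr_ge0 ?(ltW C0)// subr_ge0.
  by rewrite ge0_ler_powR ?nnegrE ?(ltW s0).
have tjp : (0 < tail n a j)%R by rewrite lt_neqAle eq_sym tj0 t0.
rewrite inver gt_eqF ?powR_gt0// -EFinM lee_fin.
have -> : a j = (tail n a j - tail n a j.+1)%R by rewrite tS addrK.
by rewrite HC// t0 tj.
Qed.

End PowerInequalities.

(** * Doubling spaces *)

(** Each use of the recurrence halves the contribution of the a priori bound: the factor [(2 B)^-1]
    beats the growth rate [B]. After infinitely many uses only the [I 0] term survives, with a
    constant independent of [M]. *)
Lemma halving_recurrence_le (R : realType) (I : nat -> \bar R) (K B M : R) :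
  0 <= K -> 0 < B -> (forall k, 0 <= I k)%E ->
  (forall k, I k <= (M * B ^+ k)%:E)%E ->
  (forall k, I k <= ((2 * B)^-1)%:E * I k.+1 + (K * B ^+ k)%:E * I 0%N)%E ->
  forall k, (I k <= (2 * K * B ^+ k)%:E * I 0%N)%E.
Proof.
move=> K0 B0 I0 IM IH.
have Ifin k : I k \is a fin_num.
  by rewrite ge0_fin_numE// (le_lt_trans (IM k)) ?ltry.
pose x k := fine (I k).
have xI k : I k = (x k)%:E by rewrite /x fineK.
have x0 k : 0 <= x k by exact: fine_ge0.
have xM k : x k <= M * B ^+ k by rewrite -lee_fin -xI.
have xH k : x k <= (2 * B)^-1 * x k.+1 + K * B ^+ k * x 0%N.
  by rewrite -lee_fin EFinD !EFinM -!xI IH.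
(* The bound after [J] uses of the recurrence; [J = 0] is the a priori bound, and [2 K] is the fixed
   point of [c -> c / 2 + K]. *)
have claim J k : x k <= B ^+ k * (2 * K * x 0%N + M / 2 ^+ J).
  elim: J k => [k|J IHJ k].
    rewrite expr0 divr1 (le_trans (xM k))// mulrC ler_wpM2l ?exprn_ge0 ?(ltW B0)//.
    by rewrite lerDr !mulr_ge0.
  rewrite (le_trans (xH k))//.
  have -> : B ^+ k * (2 * K * x 0%N + M / 2 ^+ J.+1) =
      (2 * B)^-1 * (B ^+ k.+1 * (2 * K * x 0%N + M / 2 ^+ J)) +
      K * B ^+ k * x 0%N.
    by rewrite !exprS; field; rewrite !gt_eqF// exprn_gt0.
  by rewrite lerD2r ler_wpM2l ?invr_ge0 ?mulr_ge0 ?(ltW B0).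
move=> k; rewrite !xI -EFinM lee_fin.
apply/ler_addgt0Pr => e e0.
pose c := B ^+ k * (K * x 0%N * 2).
have -> : 2 * K * B ^+ k * x 0%N = c by rewrite /c; ring.
pose J := Num.bound (B ^+ k * M / e).
have [M0|M0] := leP M 0.
  have := claim 0%N k; rewrite expr0 divr1 mulrDr => /le_trans; apply.
  have -> : B ^+ k * (2 * K * x 0%N) = c by rewrite /c; ring.
  by rewrite lerD2l (@le_trans _ _ 0) ?(ltW e0)// mulr_ge0_le0 ?exprn_ge0 ?(ltW B0).
have := claim J k; rewrite mulrDr => /le_trans; apply.
have -> : B ^+ k * (2 * K * x 0%N) = c by rewrite /c; ring.
rewrite lerD2l mulrA ler_pdivrMr ?exprn_gt0// [leRHS]mulrC -ler_pdivrMr//.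
have /ltW/le_trans : B ^+ k * M / e < J%:R.
  by apply: archi_boundP; rewrite !mulr_ge0 ?exprn_ge0 ?invr_ge0 ?(ltW B0) ?(ltW e0) ?(ltW M0).
by apply; rewrite -natrX ler_nat ltnW// ltn_expl.
Qed.

(** * Balls, volumes and separability *)

Section DoublingGeometry.
Context {R : realType} {X : pmetricType R}.
Implicit Types (x y z : X) (r e : R).

Lemma ballP x r y : ball x r y <-> mdist x y < r.
Proof. by rewrite ballEmdist. Qed.

Lemma open_ball x r : open (ball x r).
Proof.
rewrite openE => y /ballP xy; rewrite /interior.
apply/nbhs_ballP; exists (r - mdist x y) => /=; first by rewrite subr_gt0.
move=> z /ballP yz; apply/ballP; rewrite (le_lt_trans (metric_triangle _ y _))//.
by rewrite addrC -ltrBrDr.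
Qed.

Lemma measurable_ball_borel x r : measurable (ball x r : set (borel X)).
Proof. by apply: sub_sigma_algebra; exact: open_ball. Qed.

Lemma measurable_mdist x : measurable_fun setT (mdist x : borel X -> R).
Proof.
apply: (measurability _ (RGenInftyO.measurableE R)) => _ [_ [r ->] <-].
rewrite setTI; apply: sub_sigma_algebra.
rewrite (_ : _ @^-1` _ = ball x r); first exact: open_ball.
by apply/seteqP; split => y /=; rewrite in_itv/= ballEmdist.
Qed.

Local Open Scope ereal_scope.
Variable mu : {measure set (borel X) -> \bar R}.
Hypothesis mu_nondegenerate : balls_nondegenerate mu.

Lemma volume_gt0 x r : (0 < r)%R -> 0 < volume mu x r.
Proof. by move=> /mu_nondegenerate-/(_ x)/andP[]. Qed.

Lemma volume_fin_num x r : (0 < r)%R -> volume mu x r \is a fin_num.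
Proof.
by move=> /mu_nondegenerate-/(_ x)/andP[? ?]; rewrite ge0_fin_numE// measure_ge0.
Qed.

Lemma le_volume x y r s : (mdist y x + r <= s)%R ->
  volume mu x r <= volume mu y s.
Proof.
move=> xy; apply: le_measure; rewrite ?inE; [exact: measurable_ball_borel..|].
move=> z /ballP xz; apply/ballP.
by rewrite (le_lt_trans (metric_triangle _ x _))// (lt_le_trans _ xy)// ltrD2l.
Qed.

Lemma sigma_finite_balls : sigma_finite setT (mu : set (borel X) -> \bar R).
Proof.
exists (fun n => ball (point : X) n.+1%:R); last first.
  move=> n; split; first exact: measurable_ball_borel.
  by have /andP[] := mu_nondegenerate point (ltr0Sn R n).
apply/esym; rewrite -subTset => x _; exists (Num.bound (mdist point x)) => //.
apply/ballP; rewrite (@lt_trans _ _ (Num.bound (mdist (point : X) x))%:R) ?ltr_nat//.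
by apply: archi_boundP; exact: mdist_ge0.
Qed.

Variable C : R.
Hypothesis C_gt0 : (0 < C)%R.
Hypothesis volume_double : forall x r, (0 < r)%R ->
  volume mu x (2 * r)%R <= C%:E * volume mu x r.

Lemma volume_iter_double n x r : (0 < r)%R ->
  volume mu x (2 ^+ n * r)%R <= (C ^+ n)%:E * volume mu x r.
Proof.
move=> r0; elim: n => [|n IHn]; first by rewrite !expr0 mul1r mul1e.
rewrite exprS -mulrA (le_trans (volume_double _ _))//.
  by rewrite mulr_gt0// exprn_gt0.
by rewrite exprS EFinM -muleA lee_wpmul2l// lee_fin ltW.
Qed.

Definition separated e (s : seq X) := pairwise (fun x y => (e <= mdist x y)%R) s.

(** Balls of radius [e / 2] about [e]-separated points are disjoint, so their volumes add up. *)
Lemma separated_volume_le (e r : R) x0 (v : \bar R) (s : seq X) : 0 <= v ->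
  (forall x, x \in s -> (mdist x0 x < r)%R /\ v <= volume mu x (e / 2)%R) ->
  separated e s ->
  (size s)%:R%:E * v <= mu (\big[setU/set0]_(x <- s) ball x (e / 2)%R).
Proof.
move=> v0; elim: s => [|x s IHs] xs; first by rewrite /= mul0e measure_ge0.
rewrite /separated/= => /andP[/allP xsep ssep].
have mB (t : seq X) :
    measurable (\big[setU/set0]_(y <- t) ball y (e / 2)%R : set (borel X)).
  by apply: bigsetU_measurable => y _; exact: measurable_ball_borel.
rewrite big_cons measureU//=; last 2 first.
  exact: measurable_ball_borel.
  apply/seteqP; split => // z [/ballP xz]; rewrite -bigcup_seq => -[y /= ys /ballP yz].
  have := xsep _ ys; rewrite leNgt => /negP; apply.
  rewrite (le_lt_trans (metric_triangle _ z _))// (splitr e) ltrD//.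
  by rewrite metric_sym.
rewrite -natr1 addrC EFinD ge0_muleDl ?lee_fin// mul1e leeD//.
  by have [] := xs x (mem_head _ _).
by apply: IHs => // y ys; apply: xs; rewrite inE ys orbT.
Qed.

Lemma finite_net x0 r e : (0 < r)%R -> (0 < e)%R ->
  exists s : seq X, forall y, (mdist x0 y < r)%R ->
    exists2 x, x \in s & (mdist x y < e)%R.
Proof.
(* Volumes bound the size of a separated set; a largest one is a net. *)
move=> r0 e0; pose P n := `[< exists2 s : seq X, size s = n &
  (forall x, x \in s -> (mdist x0 x < r)%R) /\ separated e s >].
have e20 : (0 < e / 2)%R by rewrite divr_gt0.
(* For [x] in [B(x0, r)] this gives [B(x0, r)] inside [B(x, 2^m e / 2)], so [m] doublings bound the
   volume of [B(x, e / 2)] below by [v], uniformly in [x]. *)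
have [m rm] : exists m, (2 * r <= 2 ^+ m * (e / 2))%R.
  exists (Num.bound (2 * r / (e / 2))); rewrite -ler_pdivrMr//.
  have /ltW/le_trans : (2 * r / (e / 2) < (Num.bound (2 * r / (e / 2)))%:R)%R.
    by apply: archi_boundP; rewrite divr_ge0 ?(ltW e20)// mulr_ge0// ltW.
  by apply; rewrite -natrX ler_nat ltnW// ltn_expl.
pose v := ((C ^+ m)^-1)%:E * volume mu x0 r.
have Cm : (0 < C ^+ m)%R by rewrite exprn_gt0.
have v0 : 0 < v by rewrite mule_gt0 ?lte_fin ?invr_gt0 ?volume_gt0.
have vfin : v \is a fin_num by rewrite fin_numM// volume_fin_num.
have vle x : (mdist x0 x < r)%R -> v <= volume mu x (e / 2)%R.
  move=> x0x; rewrite /v -lee_pdivlMl ?invrK ?invr_gt0//.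
  rewrite (le_trans _ (volume_iter_double _ _ _))// le_volume//.
  by rewrite metric_sym (le_trans _ rm)// mulr_natl mulr2n lerD2r ltW.
(* The disjoint balls all lie in [B(x0, r + e)], so a separated set has at most [V / v] points. *)
pose V := volume mu x0 (r + e)%R.
have Vfin : V \is a fin_num by rewrite volume_fin_num// addr_gt0.
have bound n : P n -> (n <= Num.bound (fine V / fine v))%N.
  move=> /asboolP[s <- [sr ssep]].
  have := @separated_volume_le e r x0 v s (ltW v0).
  move=> /(_ (fun x xs => conj (sr x xs) (vle x (sr x xs)))) /(_ ssep).
  move=> /le_trans => /(_ V) sV.
  have {}sV : (size s)%:R%:E * v <= V.
    apply: sV; apply: le_measure; rewrite ?inE.
      by apply: bigsetU_measurable => y _; exact: measurable_ball_borel.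
      exact: measurable_ball_borel.
    move=> z; rewrite -bigcup_seq => -[y /= ys /ballP yz]; apply/ballP.
    rewrite (le_lt_trans (metric_triangle _ y _))// ltrD ?sr//.
    by rewrite (lt_le_trans yz)// ler_pdivrMr// ler_peMr ?ler1n// ltW.
  rewrite -(ler_nat R) ltW//.
  have : ((size s)%:R <= fine V / fine v)%R.
    rewrite ler_pdivlMr; last by rewrite fine_gt0// v0/= -ge0_fin_numE// ltW.
    by rewrite -lee_fin EFinM !fineK.
  move=> /le_lt_trans; apply; apply: archi_boundP.
  by rewrite divr_ge0 ?fine_ge0 ?measure_ge0 ?(ltW v0).
have exP : exists n, P n by exists 0%N; apply/asboolP; exists [::].
have [n /asboolP[s sn [sr ssep]] nmax] := ex_maxnP exP bound.
exists s => y yr; apply: contrapT => ynet.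
have : P n.+1.
  apply/asboolP; exists (y :: s); first by rewrite /= sn.
  split=> [x|]; first by rewrite inE => /orP[/eqP->//|/sr].
  rewrite /separated/= -/(separated e s) ssep andbT; apply/allP => x xs.
  by rewrite leNgt; apply/negP; rewrite metric_sym => xy; apply: ynet; exists x.
by move=> /nmax; rewrite ltnn.
Qed.

(** [D n] lists a net of scale [1 / (n+1)] for the ball of radius [n+1] about the base point. Tying
    the scale to [n] makes countably many balls [B(D n i, 1 / (n+1))] available for covering at
    every scale. *)
Lemma dense_double_sequence : exists D : nat -> nat -> X,
  forall x e, (0 < e)%R -> exists n, (n.+1%:R^-1 < e)%R /\
    exists i, (mdist (D n i) x < n.+1%:R^-1)%R.
Proof.
have net n := @finite_net point n.+1%:R n.+1%:R^-1 (ltr0Sn R n)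
  (ltac:(by rewrite invr_gt0)).
have [s sP] := choice net.
exists (fun n i => nth point (s n) i) => x e e0.
pose n := maxn (Num.bound (mdist point x)) (Num.bound e^-1); exists n.
have xn : (mdist point x < n.+1%:R)%R.
  have /lt_le_trans : (mdist (point : X) x < (Num.bound (mdist (point : X) x))%:R)%R.
    by apply: archi_boundP; exact: mdist_ge0.
  by apply; rewrite ler_nat leqW// leq_maxl.
split.
  rewrite invf_plt ?posrE//.
  have /lt_le_trans : (e^-1 < (Num.bound e^-1)%:R)%R.
    by apply: archi_boundP; rewrite invr_ge0 ltW.
  by apply; rewrite ler_nat leqW// leq_maxr.
have [z zs zx] := sP n x xn.
by exists (index z (s n)); rewrite nth_index.
Qed.

End DoublingGeometry.

(** * Integrals over cones *)

Lemma measurable_set_ltr d (T : measurableType d) (R : realType) (f g : T -> R) :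
  measurable_fun setT f -> measurable_fun setT g ->
  measurable [set x | f x < g x].
Proof.
move=> mf mg; rewrite -[X in measurable X]setTI.
exact: (measurable_fun_ltr mf mg measurableT (Y := [set true])).
Qed.

(** Away from [0] the extended inverse is the real power [-1] of [fine]; this includes the value
    [+oo], where both are [0]. *)
Lemma measurable_inve_ge0 d (T : measurableType d) (R : realType) (f : T -> \bar R) :
  (forall x, 0 <= f x)%E -> measurable_fun setT f ->
  measurable_fun setT (fun x => (f x)^-1)%E.
Proof.
move=> f0 mf.
have -> : (fun x => (f x)^-1)%E =
    (fun x => if f x == 0%E then +oo%E else ((fine (f x)) `^ (-1))%:E).
  apply/funext => x; have := f0 x; case: (f x) => [r r0| |//].
    by rewrite eqe inver; case: eqVneq => // _; rewrite powR_inv1.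
  by rewrite /= powR_inv1// invr0 invey.
apply: measurable_fun_if => //.
- apply: (measurable_fun_bool true); rewrite setTI.
  have := mf measurableT [set 0%E] (emeasurable_set1 _); rewrite setTI.
  by congr measurable; apply/seteqP; split=> x /= /eqP.
- apply: measurable_funTS; apply/measurable_EFinP.
  apply: (measurableT_comp (measurable_powR _)).
  exact: (measurableT_comp (fine_measurable measurableT) mf).
Qed.

(** Monotone convergence, in the form in which bounds uniform over truncations are passed to the
    limit. *)
Lemma integral_le_of_sup d (T : measurableType d) (R : realType)
    (mu : {measure set T -> \bar R}) (D : set T) (f : T -> \bar R)
    (f_ : nat -> T -> \bar R) (c : \bar R) :
  measurable D -> (forall n, measurable_fun D (f_ n)) ->
  (forall n x, D x -> 0 <= f_ n x)%E ->
  (forall x, D x -> {homo (fun n => f_ n x) : m n / (m <= n)%N >-> (m <= n)%E}) ->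
  measurable_fun D f -> (forall x, D x -> 0 <= f x)%E ->
  (forall x, D x -> f x <= ereal_sup (range (fun n => f_ n x)))%E ->
  (forall n, \int[mu]_(x in D) f_ n x <= c)%E ->
  (\int[mu]_(x in D) f x <= c)%E.
Proof.
move=> mD mf_ f_0 f_nd mf f0 f_sup intf_.
have cvgf x : D x -> f_ n x @[n --> \oo] --> ereal_sup (range (fun n => f_ n x)).
  by move=> Dx; apply: ereal_nondecreasing_cvgn; exact: f_nd.
apply: (@le_trans _ _ (\int[mu]_(x in D) limn (fun n => f_ n x))%E).
  apply: ge0_le_integral => //.
  - apply: (emeasurable_fun_cvg f_) => // x Dx.
    by rewrite (cvg_lim _ (cvgf x Dx))//; exact: cvgf.
  - by move=> x Dx; rewrite (cvg_lim _ (cvgf x Dx))//; exact: f_sup.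
rewrite monotone_convergence//; apply: lime_le; last exact: nearW.
apply: ereal_nondecreasing_is_cvgn => m n mn.
by apply: ge0_le_integral => // [x Dx|x Dx]; [exact: f_0|exact: f_nd].
Qed.

Section ConeIntegral.
Context {R : realType} {X : pmetricType R}.
Variable mu : {sigma_finite_measure set (borel X) -> \bar R}.
Hypothesis mu_nondegenerate : balls_nondegenerate mu.
Variable C : R.
Hypothesis C_gt0 : 0 < C.
Hypothesis volume_double : forall x r, 0 < r ->
  (volume mu x (2 * r)%R <= C%:E * volume mu x r)%E.

Context d (Z : measurableType d).
Variable nu : {sigma_finite_measure set Z -> \bar R}.
Variables (loc : Z -> X) (ht : Z -> R).
Hypothesis measurable_loc : measurable_fun setT (loc : Z -> borel X).
Hypothesis measurable_ht : measurable_fun setT ht.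

Local Open Scope ereal_scope.

(* [Z] is an abstract upper half-space: [loc z] and [ht z] are the space and height
   coordinates of [z]. *)
Definition zcone (r : R) (x : X) : set Z :=
  [set z | (0 < ht z)%R /\ (mdist x (loc z) < r * ht z)%R].

Definition cone_graph (r : R) : set (borel X * Z) :=
  [set w | zcone r w.1 w.2].

(** The cone condition is a strict inequality, so it survives replacing the vertex by a near enough
    net point. The graph is thus a countable union of measurable rectangles. *)
Lemma measurable_cone_graph r : measurable (cone_graph r).
Proof.
have [D DP] := dense_double_sequence mu_nondegenerate C_gt0 volume_double.
pose B n i : set Z := [set z | (0 < ht z)%R] `&`
  [set z | (n.+1%:R^-1 + mdist (D n i) (loc z) < r * ht z)%R].
(* This is where separability is needed: without it the distance function need
   not be measurable for the product sigma-algebra. *)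
have -> : cone_graph r = \bigcup_n \bigcup_i (ball (D n i) n.+1%:R^-1 `*` B n i).
  apply/seteqP; split => [[x z] [/= z0 xz]|[x z] [n _ [i _ [/= /ballP Dx [z0 zB]]]]].
    (* Half of the gap, because the net scale is spent twice: in the definition of [B] and in the
       triangle inequality. *)
    have [] := DP x ((r * ht z - mdist x (loc z)) / 2)%R.
      by rewrite divr_gt0// subr_gt0.
    move=> n [ne [i Dx]]; exists n => //; exists i => //.
    split; [exact/ballP|split=> //=].
    have := metric_triangle (D n i) x (loc z).
    move: ne Dx; set e := n.+1%:R^-1%R; lra.
  split=> //=; rewrite (le_lt_trans (metric_triangle _ (D n i) _))//.
  rewrite (le_lt_trans _ zB)// lerD2r ltW// metric_sym//.
apply: bigcupT_measurable => n; apply: bigcupT_measurable => i.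
apply: measurableX; first exact: measurable_ball_borel.
apply: measurableI; first exact: measurable_set_ltr.
apply: measurable_set_ltr; last exact: measurable_funM.
apply: measurable_funD => //.
exact: (measurableT_comp (measurable_mdist (D n i)) measurable_loc).
Qed.

Lemma measurable_zcone r x : measurable (zcone r x).
Proof.
rewrite (_ : zcone r x = xsection (cone_graph r) (x : borel X)).
  by apply: measurable_xsection; exact: measurable_cone_graph.
by apply/seteqP; split=> z; rewrite /xsection/= inE.
Qed.

Definition cone_int r (G : Z -> \bar R) (x : borel X) := \int[nu]_(z in zcone r x) G z.

Definition cone_base r z : set (borel X) := [set x | zcone r x z].

Lemma in_cone_graph r (x : borel X) z :
  ((x, z) \in cone_graph r) = (z \in zcone r x).
Proof. by apply/idP/idP; rewrite !inE. Qed.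

Lemma in_cone_base r x z : (x \in cone_base r z) = (z \in zcone r x).
Proof. by apply/idP/idP; rewrite !inE. Qed.

(** The integrand on the product to which Tonelli is applied; its two partial integrals are computed
    in [kernel_int_z] and [kernel_int_x]. *)
Let kernel r (Phi : borel X -> \bar R) (G : Z -> \bar R) :=
  (fun w : borel X * Z => Phi w.1 * G w.2) \_ (cone_graph r).

(** * Tonelli's theorem for cones *)

Section Tonelli.
Variables (r : R) (Phi : borel X -> \bar R) (G : Z -> \bar R).
Hypothesis Phi_ge0 : forall x, 0 <= Phi x.
Hypothesis measurable_Phi : measurable_fun setT Phi.
Hypothesis G_ge0 : forall z, 0 <= G z.
Hypothesis measurable_G : measurable_fun setT G.

Lemma kernel_ge0 w : 0 <= kernel r Phi G w.
Proof. by rewrite /kernel patchE; case: ifP => // _; rewrite mule_ge0. Qed.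

Lemma measurable_kernel : measurable_fun setT (kernel r Phi G).
Proof.
apply/(measurable_restrictT _ _).1; first exact: measurable_cone_graph.
apply: measurable_funTS; apply: emeasurable_funM.
  exact: (measurableT_comp measurable_Phi measurable_fst).
exact: (measurableT_comp measurable_G measurable_snd).
Qed.

Lemma kernel_int_z x :
  \int[nu]_z kernel r Phi G (x, z) = Phi x * cone_int r G x.
Proof.
rewrite /cone_int -ge0_integralZl//; last 2 first.
- exact: measurable_zcone.
- exact: measurable_funTS.
rewrite integral_mkcond; apply: eq_integral => z _.
by rewrite /kernel !patchE in_cone_graph.
Qed.

Lemma measurable_cone_base z : measurable (cone_base r z).
Proof.
rewrite (_ : cone_base r z = ysection (cone_graph r) z).
  by apply: measurable_ysection; exact: measurable_cone_graph.
by apply/seteqP; split=> x; rewrite /ysection/= inE.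
Qed.

Lemma kernel_int_x z :
  \int[mu]_x kernel r Phi G (x, z) = G z * \int[mu]_(x in cone_base r z) Phi x.
Proof.
rewrite -ge0_integralZl//; last 2 first.
- exact: measurable_cone_base.
- exact: measurable_funTS.
rewrite integral_mkcond; apply: eq_integral => x _.
by rewrite /kernel !patchE in_cone_graph in_cone_base muleC.
Qed.

Lemma cone_int_tonelli : \int[mu]_x (Phi x * cone_int r G x) =
  \int[nu]_z (G z * \int[mu]_(x in cone_base r z) Phi x).
Proof.
under eq_integral do rewrite -kernel_int_z.
under [RHS]eq_integral do rewrite -kernel_int_x.
exact: (fubini_tonelli (kernel r Phi G) measurable_kernel kernel_ge0).
Qed.

(** A partial integral of [kernel] is measurable. With constant functions this also gives the
    measurability of ball volumes in centre and radius. *)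
Lemma measurable_mul_base_int :
  measurable_fun setT (fun z => G z * \int[mu]_(x in cone_base r z) Phi x).
Proof.
under eq_fun do rewrite -kernel_int_x.
exact: (measurable_fun_fubini_tonelli_G (kernel r Phi G) measurable_kernel kernel_ge0).
Qed.

Lemma measurable_mul_cone_int : measurable_fun setT (fun x => Phi x * cone_int r G x).
Proof.
under eq_fun do rewrite -kernel_int_z.
exact: (measurable_fun_fubini_tonelli_F (kernel r Phi G) measurable_kernel kernel_ge0).
Qed.

End Tonelli.

Lemma cone_int_ge0 r G x : (forall z, 0 <= G z) -> 0 <= cone_int r G x.
Proof. by move=> G0; apply: integral_ge0. Qed.

Lemma measurable_cone_int r G : (forall z, 0 <= G z) -> measurable_fun setT G ->
  measurable_fun setT (cone_int r G).
Proof.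
move=> G0 mG.
have : measurable_fun setT (fun x => cst 1 x * cone_int r G x).
  by apply: measurable_mul_cone_int => // x; exact: lee01.
by under eq_fun do rewrite mul1e.
Qed.

Lemma cone_baseE r z : (0 < ht z)%R -> cone_base r z = ball (loc z) (r * ht z)%R.
Proof.
move=> z0; apply/seteqP; split=> [x [_ /= xz]|x /ballP xz].
  by apply/ballP; rewrite metric_sym.
by split=> //; rewrite metric_sym.
Qed.

(** Averaging the pointwise comparison over [x'] bounds [Phi] on the ball of radius [rb] by the mean
    of [Psi] over the ball of radius [ra]; the ratio of volumes then gives [K]. *)
Lemma ball_int_le y rb ra K (Phi Psi : borel X -> \bar R) :
  (0 < ra)%R -> (0 <= K)%R ->
  (forall x, 0 <= Phi x) -> measurable_fun setT Phi ->
  (forall x, 0 <= Psi x) -> measurable_fun setT Psi ->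
  volume mu y rb <= K%:E * volume mu y ra ->
  (forall x x', (mdist y x < rb)%R -> (mdist y x' < ra)%R -> Phi x <= Psi x') ->
  \int[mu]_(x in ball y rb) Phi x <= K%:E * \int[mu]_(x in ball y ra) Psi x.
Proof.
move=> ra0 K0 Phi0 mPhi Psi0 mPsi VK PP.
have mB r := measurable_ball_borel y r.
set c := \int[mu]_(x in ball y ra) Psi x.
have c0 : 0 <= c by apply: integral_ge0.
have Vf := volume_fin_num mu_nondegenerate y ra0.
have V0 := volume_gt0 mu_nondegenerate y ra0.
pose v := fine (volume mu y ra).
have vE : volume mu y ra = v%:E by rewrite /v fineK.
have v0 : (0 < v)%R by rewrite -lte_fin -vE.
have Phile x : (mdist y x < rb)%R -> Phi x <= v^-1%:E * c.
  move=> yx; rewrite lee_pdivlMl// -vE muleC /volume -integral_cst//.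
  apply: ge0_le_integral => //.
  - by move=> x' _ /=.
  - exact: measurable_funTS.
  - by move=> x' /ballP yx'; apply: PP.
apply: (@le_trans _ _ (\int[mu]_(x in ball y rb) cst (v^-1%:E * c) x)).
  apply: ge0_le_integral => //.
  - exact: measurable_funTS.
  - by move=> x /ballP yx; exact: Phile.
rewrite integral_cst// (le_trans (lee_wpmul2l _ VK))//.
  by rewrite mule_ge0// lee_fin invr_ge0 ltW.
rewrite vE muleCA lee_wpmul2l ?lee_fin// muleAC -EFinM mulVf ?gt_eqF//.
by rewrite mul1e.
Qed.

(** After Tonelli on both sides, [ball_int_le] applies at each [z]. Vertices of cones of apertures
    [b] and [a] that contain [z] are closer than [(a + b) ht z], which is at most [2 (a + b) tau] on
    the support of [G]. *)
Lemma cone_int_transfer a b tau K (G : Z -> \bar R) (Phi Psi : borel X -> \bar R) :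
  (0 < a)%R -> (0 < b)%R -> (0 < tau)%R -> (0 <= K)%R ->
  (forall y t, (0 < t)%R ->
    volume mu y (b * t)%R <= K%:E * volume mu y (a * t)%R) ->
  (forall z, 0 <= G z) -> measurable_fun setT G ->
  (forall z, G z != 0 -> (tau <= ht z < 2 * tau)%R) ->
  (forall x, 0 <= Phi x) -> measurable_fun setT Phi ->
  (forall x, 0 <= Psi x) -> measurable_fun setT Psi ->
  (forall x x', (mdist x x' < 2 * (a + b) * tau)%R -> Phi x <= Psi x') ->
  \int[mu]_x (Phi x * cone_int b G x) <=
  K%:E * \int[mu]_x (Psi x * cone_int a G x).
Proof.
move=> a0 b0 tau0 K0 VK G0 mG suppG Phi0 mPhi Psi0 mPsi PP.
rewrite !cone_int_tonelli// -ge0_integralZl//; last 2 first.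
- exact: measurable_mul_base_int.
- by move=> z _; rewrite mule_ge0// integral_ge0.
apply: ge0_le_integral => //.
- by move=> z _; rewrite mule_ge0// integral_ge0.
- exact: measurable_mul_base_int.
- by apply: measurable_funeM; exact: measurable_mul_base_int.
move=> z _; have [->|/suppG/andP[tz zt]] := eqVneq (G z) 0.
  by rewrite !mul0e mule0.
have z0 : (0 < ht z)%R by rewrite (lt_le_trans tau0).
rewrite muleCA lee_wpmul2l// !cone_baseE//; apply: ball_int_le => //.
- by rewrite mulr_gt0.
- exact: VK.
- move=> x x' xz xz'; apply: PP.
  rewrite (le_lt_trans (metric_triangle _ (loc z) _))// metric_sym.
  rewrite (lt_le_trans (ltrD xz xz'))// -mulrDl addrC mulrAC [leRHS]mulrC.
  by rewrite ler_wpM2l ?(ltW zt)// ltW// addr_gt0.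
Qed.

(** At heights [t >= tau] a shift of the vertex by [e tau] is at most [e t], which the wider
    aperture absorbs. *)
Lemma cone_int_shift r e tau G x x' : (0 <= e)%R ->
  (forall z, 0 <= G z) -> measurable_fun setT G ->
  (forall z, G z != 0 -> (tau <= ht z)%R) ->
  (mdist x x' <= e * tau)%R -> cone_int r G x <= cone_int (r + e) G x'.
Proof.
move=> e0 G0 mG suppG xx'; rewrite /cone_int integral_mkcond [leRHS]integral_mkcond.
have mc := measurable_zcone.
apply: ge0_le_integral => //.
- by move=> z _; rewrite patchE; case: ifP.
- by apply/(measurable_restrictT _ _).1 => //; exact: measurable_funTS.
- by apply/(measurable_restrictT _ _).1 => //; exact: measurable_funTS.
move=> z _; rewrite !patchE; case: ifPn => [|_]; last by case: ifP.
rewrite inE => -[z0 xz]; case: ifPn => //.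
rewrite notin_setE => zx'; rewrite leNgt; apply/negP => Gz.
apply: zx'; split=> //.
rewrite (le_lt_trans (metric_triangle _ x _))// metric_sym mulrDl addrC ltr_leD//.
by rewrite (le_trans xx')// ler_wpM2l// suppG// gt_eqF.
Qed.

Lemma cone_int_sum r (G : nat -> Z -> \bar R) m n x :
  (forall i z, 0 <= G i z) -> (forall i, measurable_fun setT (G i)) ->
  cone_int r (fun z => \sum_(m <= i < n) G i z) x =
  \sum_(m <= i < n) cone_int r (G i) x.
Proof.
move=> G0 mG; rewrite /cone_int ge0_integral_sum//; first exact: measurable_zcone.
by move=> i; exact: measurable_funTS.
Qed.

(** A factor [5 <= 2^3] in the radius costs three doublings. *)
Lemma volume_pow5_le k a y t : (0 < a)%R -> (0 < t)%R ->
  volume mu y (a * 5 ^+ k * t)%R <= ((C ^+ 3) ^+ k)%:E * volume mu y (a * t)%R.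
Proof.
move=> a0 t0; rewrite -exprM.
apply: le_trans (volume_iter_double C_gt0 volume_double (3 * k) y (mulr_gt0 a0 t0)).
apply: le_volume; rewrite mdistxx add0r exprM mulrAC [leRHS]mulrC.
rewrite ler_wpM2l ?mulr_ge0 ?(ltW a0) ?(ltW t0)//.
by rewrite lerXn2r ?nnegrE//; lra.
Qed.

(** * The recurrence for finitely many height slabs *)

Section Slabs.
(* [G i] is the part of the density at heights in [[tau i, 2 tau i)]. *)
Variables (a : R) (n : nat) (tau : nat -> R) (G : nat -> Z -> \bar R).
Hypothesis a_gt0 : (0 < a)%R.
Hypothesis tau_gt0 : forall i, (0 < tau i)%R.
Hypothesis tau_nd : {homo tau : i j / (i <= j)%N >-> (i <= j)%R}.
Hypothesis G_ge0 : forall i z, 0 <= G i z.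
Hypothesis measurable_G : forall i, measurable_fun setT (G i).
Hypothesis G_support : forall i z, G i z != 0 -> (tau i <= ht z < 2 * tau i)%R.

Let rho k := (a * 5 ^+ k)%R.
Let h k i := cone_int (rho k) (G i).
(** The discrete [A_r^(>=t)], with [r = rho k] and [t = tau j]. *)
Let S k j x := \sum_(j <= i < n) h k i x.

Hypothesis h_fin : forall k i x, h k i x \is a fin_num.

Let h_ge0 k i x : 0 <= h k i x.
Proof. exact: cone_int_ge0. Qed.

Let measurable_h k i : measurable_fun setT (h k i).
Proof. exact: measurable_cone_int. Qed.

Let S_ge0 k j x : 0 <= S k j x.
Proof. by apply: sume_ge0 => i _. Qed.

Let measurable_S k j : measurable_fun setT (S k j).
Proof. by apply: emeasurable_sum => i. Qed.

Let SE k j x : S k j x = (\sum_(j <= i < n) fine (h k i x))%:E.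
Proof. by rewrite /S -sumEFin; apply: eq_bigr => i _; rewrite fineK. Qed.

Let rho_gt0 k : (0 < rho k)%R.
Proof. by rewrite mulr_gt0// exprn_gt0. Qed.

Let rhoS k : rho k.+1 = (5 * rho k)%R.
Proof. by rewrite /rho exprS mulrCA. Qed.

Let rho_ge k : (a <= rho k)%R.
Proof. by rewrite /rho ler_peMr ?(ltW a_gt0)// exprn_ege1//; lra. Qed.

(** [cone_int_shift] on each slab [i >= j], where [tau j <= tau i]. The distance allowed is the one
    that [cone_int_transfer] demands for apertures [a] and [rho m]. *)
Let S_shift k l m j x x' : (rho k + 2 * (a + rho m) <= rho l)%R ->
  (mdist x x' < 2 * (a + rho m) * tau j)%R -> S k j x <= S l j x'.
Proof.
move=> kl xx'; rewrite /S big_nat_cond [leRHS]big_nat_cond.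
apply: lee_sum => i /andP[/andP[ji _] _].
have e0 : (0 <= rho l - rho k)%R.
  by have := rho_gt0 m; move: kl a_gt0; lra.
have := @cone_int_shift (rho k) (rho l - rho k)%R (tau i) (G i) x x' e0 (G_ge0 i)
  (measurable_G i); rewrite -/(h k i) addrCA subrr addr0; apply.
  by move=> z /G_support/andP[].
rewrite (le_trans (ltW xx'))// ler_pM//.
- by rewrite mulr_ge0// addr_ge0 ?(ltW a_gt0) ?(ltW (rho_gt0 m)).
- exact: ltW.
- by move: kl; lra.
- exact: tau_nd.
Qed.

(** This fixes the ratio [5] of consecutive apertures: [rho k + 2 (a + rho k) <= 5 rho k], as
    [a <= rho k]. *)
Let S_step k j x x' : (mdist x x' < 2 * (a + rho k) * tau j)%R ->
  S k j x <= S k.+1 j x'.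
Proof. by apply: S_shift; rewrite rhoS; have := rho_ge k; lra. Qed.

Let S_mono k x : S k 0%N x <= S k.+1 0%N x.
Proof.
apply: S_step; rewrite mdistxx !mulr_gt0// addr_gt0//.
Qed.

Let S_tail k j x : S k j x <= S k 0%N x.
Proof.
rewrite /S; have [jn|nj] := leqP j n.
  by rewrite [leRHS](big_cat_nat (n := j))//= leeDr// sume_ge0.
by rewrite big_geq ?(ltnW nj)// sume_ge0.
Qed.

Let transfer_sum k (Phi Psi : nat -> borel X -> \bar R) :
  (forall j x, 0 <= Phi j x) -> (forall j, measurable_fun setT (Phi j)) ->
  (forall j x, 0 <= Psi j x) -> (forall j, measurable_fun setT (Psi j)) ->
  (forall j x x', (mdist x x' < 2 * (a + rho k) * tau j)%R -> Phi j x <= Psi j x') ->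
  \int[mu]_x (\sum_(0 <= j < n) Phi j x * h k j x) <=
  ((C ^+ 3) ^+ k)%:E * \int[mu]_x (\sum_(0 <= j < n) Psi j x * h 0%N j x).
Proof.
move=> Phi0 mPhi Psi0 mPsi PP.
rewrite ge0_integral_sum//; last 2 first.
- by move=> j; exact: emeasurable_funM.
- by move=> j x _; rewrite mule_ge0.
rewrite ge0_integral_sum//; last 2 first.
- by move=> j; exact: emeasurable_funM.
- by move=> j x _; rewrite mule_ge0.
rewrite ge0_sume_distrr; last first.
  by move=> j _; apply: integral_ge0 => x _; rewrite mule_ge0.
apply: lee_sum => j _; rewrite /h [rho 0]mulr1.
apply: (@cone_int_transfer a (rho k) (tau j)) => //.
- by rewrite !exprn_ge0// ltW.
- by move=> y t t0; exact: volume_pow5_le.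
- by move=> z; exact: G_support.
- by move=> x x'; exact: PP.
Qed.

Let I s k := \int[mu]_x (S k 0%N x `^ s).

Let I_comb s e K k (F : borel X -> \bar R) : (0 <= e)%R -> (0 <= K)%R ->
  (forall x, 0 <= F x) -> measurable_fun setT F ->
  \int[mu]_x (e%:E * S k 0%N x `^ s + K%:E * F x) =
  e%:E * I s k + K%:E * \int[mu]_x F x.
Proof.
move=> e0 K0 F0 mF.
have mS : measurable_fun setT (fun x => S k 0%N x `^ s).
  exact: (measurableT_comp (measurable_poweR s) (measurable_S k 0%N)).
rewrite ge0_integralD//.
- rewrite ge0_integralZl ?lee_fin//; last by move=> x _; exact: poweR_ge0.
  by rewrite ge0_integralZl ?lee_fin.
- by move=> x _; rewrite mule_ge0 ?lee_fin// poweR_ge0.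
- exact: measurable_funeM.
- by move=> x _; rewrite mule_ge0 ?lee_fin.
- exact: measurable_funeM.
Qed.

Let measurable_pow s k j : measurable_fun setT (fun x => S k j x `^ s).
Proof.
exact: (measurableT_comp (measurable_poweR s) (measurable_S k j)).
Qed.

(** Linearise, transfer to aperture [a], then apply Young. The power inequality is a hypothesis so
    that its constant [c] is chosen before the slabs. *)
Lemma energy_step_ge1 s c e k : (1 <= s)%R -> (0 < c)%R -> (0 < e)%R ->
  (forall m (b : nat -> R), (forall i, 0 <= b i)%R ->
    ((\sum_(0 <= i < m) b i) `^ s <=
     c * \sum_(0 <= j < m) b j * (\sum_(j <= i < m) b i) `^ (s - 1))%R) ->
  I s k <= e%:E * I s k.+1 +
    (e `^ (1 - s) * (c * (C ^+ 3) ^+ k) `^ s)%:E * I s 0%N.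
Proof.
move=> s1 c0 e0 sumP.
have C30 : (0 < (C ^+ 3) ^+ k)%R by rewrite !exprn_gt0.
have s10 : (0 <= s - 1)%R by rewrite subr_ge0.
apply: (@le_trans _ _
  (\int[mu]_x (c%:E * \sum_(0 <= j < n) S k j x `^ (s - 1) * h k j x))).
  apply: ge0_le_integral => //.
  - by move=> x _; exact: poweR_ge0.
  - apply: measurable_funeM; apply: emeasurable_sum => j.
    exact: emeasurable_funM.
  move=> x _; rewrite SE poweR_EFin.
  have := sumP n (fun i => fine (h k i x)) (fun i => fine_ge0 (h_ge0 k i x)).
  rewrite -lee_fin => /le_trans; apply.
  rewrite EFinM lee_wpmul2l ?lee_fin ?(ltW c0)// -sumEFin lee_sum// => j _.
  by rewrite EFinM fineK// muleC SE.
rewrite ge0_integralZl//; last 3 first.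
- by apply: emeasurable_sum => j; exact: emeasurable_funM.
- by move=> x _; apply: sume_ge0 => j _; rewrite mule_ge0// poweR_ge0.
- by rewrite lee_fin ltW.
apply: (@le_trans _ _ (c%:E * (((C ^+ 3) ^+ k)%:E *
    \int[mu]_x (\sum_(0 <= j < n) S k.+1 j x `^ (s - 1) * h 0%N j x)))).
  rewrite lee_wpmul2l ?lee_fin ?(ltW c0)//; apply: transfer_sum => //.
  - by move=> j x; exact: poweR_ge0.
  - by move=> j x; exact: poweR_ge0.
  - move=> j x x' xx'; apply: gt0_ler_poweR => //; last exact: S_step.
    + by rewrite in_itv/= S_ge0 leey.
    + by rewrite in_itv/= S_ge0 leey.
rewrite muleA -EFinM -I_comb ?(ltW e0) ?mulr_ge0 ?powR_ge0//; last first.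
  by move=> x; exact: poweR_ge0.
rewrite -ge0_integralZl//; last 3 first.
- by apply: emeasurable_sum => j; exact: emeasurable_funM.
- by move=> x _; apply: sume_ge0 => j _; rewrite mule_ge0// poweR_ge0.
- by rewrite lee_fin mulr_ge0// ltW.
apply: ge0_le_integral => //.
- move=> x _; rewrite mule_ge0 ?lee_fin ?mulr_ge0 ?(ltW c0) ?(ltW C30)//.
  by apply: sume_ge0 => j _; rewrite mule_ge0// poweR_ge0.
- apply: measurable_funeM; apply: emeasurable_sum => j.
  exact: emeasurable_funM.
- by apply: emeasurable_funD; exact: measurable_funeM.
move=> x _.
(* Since [s - 1 >= 0], each tail may be replaced by the full sum, after which the slabs of aperture
   [a] add up to [S 0 0]. *)
apply: (@le_trans _ _ ((c * (C ^+ 3) ^+ k)%:E *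
    (S k.+1 0%N x `^ (s - 1) * S 0%N 0%N x))).
  rewrite lee_wpmul2l ?lee_fin ?mulr_ge0 ?(ltW c0) ?(ltW C30)//.
  rewrite {2}/S ge0_sume_distrr//; apply: lee_sum => j _.
  rewrite lee_wpmul2r//; apply: gt0_ler_poweR => //.
  - by rewrite in_itv/= S_ge0 leey.
  - by rewrite in_itv/= S_ge0 leey.
rewrite !SE !poweR_EFin -!EFinM -EFinD lee_fin.
have b0 k' : (0 <= \sum_(0 <= i < n) fine (h k' i x))%R.
  by rewrite -lee_fin -SE.
(* Young is applied with the constants included in the factor [a], so they reappear to the power
   [s]. *)
rewrite mulrCA mulrC (le_trans (mul_powR_young s1 e0 _ (b0 _)))//.
  by rewrite !mulr_ge0// ?(ltW c0) ?(ltW C30).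
by rewrite lerD2l powRM ?mulrA// mulr_ge0 ?(ltW c0) ?(ltW C30).
Qed.

(* [psi s] is the power [s - 1], with value [+oo] at [0]. *)
Let psi s k j x := (S k j x `^ (1 - s))^-1.

Let psi_ge0 s k j x : 0 <= psi s k j x.
Proof. by rewrite inve_ge0 poweR_ge0. Qed.

Let measurable_psi s k j : measurable_fun setT (psi s k j).
Proof.
by apply: measurable_inve_ge0 => // x; exact: poweR_ge0.
Qed.

Let psi_anti s k j x k' j' x' : (s < 1)%R ->
  S k' j' x' <= S k j x -> psi s k j x <= psi s k' j' x'.
Proof.
move=> s1 SS; rewrite /psi lee_pV2 ?inE ?poweR_ge0//.
apply: gt0_ler_poweR => //; rewrite ?subr_ge0 ?(ltW s1)//.
- by rewrite in_itv/= S_ge0 leey.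
- by rewrite in_itv/= S_ge0 leey.
Qed.

(** The order is reversed compared with [s >= 1]: Young comes first, pointwise, and the telescoping
    inequality is used last, at aperture [a]. *)
Lemma energy_step_lt1 s c e K k : (0 < s)%R -> (s < 1)%R -> (0 < c)%R ->
  (0 < e)%R -> (0 < K)%R ->
  (forall m (b : nat -> R), (forall i, 0 <= b i)%R ->
    \sum_(0 <= j < m) (b j)%:E * (((\sum_(j <= i < m) b i) `^ (1 - s))%:E)^-1
    <= (c * (\sum_(0 <= i < m) b i) `^ s)%:E) ->
  (forall u v, (0 <= u <= v)%R ->
    (u `^ s)%:E <= (e * v `^ s)%:E + K%:E * (u%:E * ((v `^ (1 - s))%:E)^-1)) ->
  I s k <= e%:E * I s k.+1 + (K * (c * (C ^+ 3) ^+ k))%:E * I s 0%N.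
Proof.
move=> s0 s1 c0 e0 K0 sumP youngP.
have C30 : (0 < (C ^+ 3) ^+ k)%R by rewrite !exprn_gt0.
have mPh (k' k'' : nat) :
    measurable_fun setT (fun x => \sum_(0 <= j < n) psi s k' j x * h k'' j x).
  by apply: emeasurable_sum => j; exact: emeasurable_funM.
have Ph0 k' k'' x : 0 <= \sum_(0 <= j < n) psi s k' j x * h k'' j x.
  by apply: sume_ge0 => j _; rewrite mule_ge0.
apply: (@le_trans _ _ (\int[mu]_x (e%:E * S k.+1 0%N x `^ s +
    K%:E * \sum_(0 <= j < n) psi s k.+1 j x * h k j x))).
  apply: ge0_le_integral => //.
  - by move=> x _; exact: poweR_ge0.
  - by apply: emeasurable_funD; exact: measurable_funeM.
  move=> x _.
  apply: (@le_trans _ _ (e%:E * S k.+1 0%N x `^ s +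
      K%:E * (S k 0%N x * psi s k.+1 0%N x))).
    rewrite /psi !SE !poweR_EFin -EFinM; apply: youngP.
    by rewrite -lee_fin -SE S_ge0/= -lee_fin -!SE S_mono.
  (* Passing from the full sum to the smaller tails increases the negative power [psi]. *)
  rewrite leeD2l// lee_wpmul2l ?lee_fin ?(ltW K0)// muleC /S ge0_sume_distrr//.
  by apply: lee_sum => j _; rewrite lee_wpmul2r// psi_anti// S_tail.
rewrite I_comb ?(ltW e0) ?(ltW K0)// leeD2l// EFinM -muleA.
rewrite lee_wpmul2l ?lee_fin ?(ltW K0)//.
apply: (le_trans (@transfer_sum k (psi s k.+1) (psi s 0%N) _ _ _ _ _)) => //.
  (* The negative power calls for a lower bound of [S k.+1 j x] by [S 0 j x']; the apertures allow
     it because [3 a + 2 rho k <= 5 rho k]. *)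
  move=> j x x' xx'; apply: psi_anti => //; apply: (@S_shift _ _ k).
    by rewrite rhoS /rho mulr1; have := rho_ge k; rewrite /rho; lra.
  by rewrite metric_sym.
rewrite mulrC EFinM -muleA lee_wpmul2l ?lee_fin ?(ltW C30)//.
rewrite -ge0_integralZl ?lee_fin ?(ltW c0)//; last first.
  by move=> x _; exact: poweR_ge0.
apply: ge0_le_integral => //; first exact: measurable_funeM.
move=> x _; rewrite SE poweR_EFin -EFinM.
have := sumP n (fun i => fine (h 0%N i x)) (fun i => fine_ge0 (h_ge0 0%N i x)).
apply: le_trans; apply: lee_sum => j _.
by rewrite /psi SE poweR_EFin fineK// muleC.
Qed.

End Slabs.

(** The energy steps feed [halving_recurrence_le]. The a priori bound [M0] may depend on the slabs,
    while [M] is chosen before them. *)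
Lemma slab_aperture_le a s k : (0 < a)%R -> (0 < s)%R ->
  exists2 M, (0 < M)%R & forall n (tau : nat -> R) (G : nat -> Z -> \bar R) M0,
    (forall i, 0 < tau i)%R ->
    {homo tau : i j / (i <= j)%N >-> (i <= j)%R} ->
    (forall i z, 0 <= G i z) -> (forall i, measurable_fun setT (G i)) ->
    (forall i z, G i z != 0 -> (tau i <= ht z < 2 * tau i)%R) ->
    (forall l i x, cone_int (a * 5 ^+ l) (G i) x \is a fin_num) ->
    let I l := \int[mu]_x
      ((\sum_(0 <= i < n) cone_int (a * 5 ^+ l) (G i) x) `^ s) in
    (0 <= M0)%R -> (forall l, I l <= (M0 * (C ^+ 3) ^+ l)%:E) ->
    I k <= M%:E * I 0%N.
Proof.
move=> a0 s0.
(* The rate [E] must not depend on [e], because [e] is then chosen in terms of [E]. *)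
suff [E [K [E0 KP]]] : exists E, exists K : R -> R, (0 < E)%R /\
  forall e, (0 < e)%R -> (0 < K e)%R /\
  forall n (tau : nat -> R) (G : nat -> Z -> \bar R),
    (forall i, 0 < tau i)%R ->
    {homo tau : i j / (i <= j)%N >-> (i <= j)%R} ->
    (forall i z, 0 <= G i z) -> (forall i, measurable_fun setT (G i)) ->
    (forall i z, G i z != 0 -> (tau i <= ht z < 2 * tau i)%R) ->
    (forall l i x, cone_int (a * 5 ^+ l) (G i) x \is a fin_num) ->
    let I l := \int[mu]_x
      ((\sum_(0 <= i < n) cone_int (a * 5 ^+ l) (G i) x) `^ s) in
    forall l, I l <= e%:E * I l.+1 + (K e * E ^+ l)%:E * I 0%N.
  (* [B] dominates both the rate of the constants and the growth rate of [I]. *)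
  pose B := Num.max E (C ^+ 3)%R.
  have B0 : (0 < B)%R by rewrite lt_max E0.
  have e0 : (0 < (2 * B)^-1)%R by rewrite invr_gt0 mulr_gt0.
  have [K0 KB] := KP _ e0.
  exists (2 * K (2 * B)^-1 * B ^+ k)%R.
    by rewrite !mulr_gt0// exprn_gt0.
  move=> n tau G M0 tau0 taund G0 mG suppG finG I M00 IM.
  have I0 l : 0 <= I l by apply: integral_ge0 => x _; exact: poweR_ge0.
  apply: (@halving_recurrence_le R I _ _ M0) => //; first exact: ltW.
  - move=> l; rewrite (le_trans (IM l))// lee_fin ler_wpM2l//.
    by rewrite lerXn2r ?nnegrE ?exprn_ge0 ?(ltW B0) ?(ltW C_gt0)// le_max lexx orbT.
  - move=> l; rewrite (le_trans (KB n tau G tau0 taund G0 mG suppG finG l))//.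
    apply: leeD2l; apply: lee_wpmul2r; first exact: (I0 0%N).
    rewrite lee_fin ler_wpM2l ?(ltW K0)//.
    by rewrite lerXn2r ?nnegrE ?(ltW B0) ?(ltW E0)// le_max lexx.
have [s1|s1] := leP 1%R s.
  have [c c0 cP] := powR_sum_le s1.
  exists ((C ^+ 3) `^ s)%R, (fun e => e `^ (1 - s) * c `^ s)%R.
  split=> [|e e0]; first by apply: powR_gt0; rewrite exprn_gt0.
  split=> [|n tau G tau0 taund G0 mG suppG finG I l].
    by rewrite mulr_gt0 ?powR_gt0.
  have := energy_step_ge1 n a0 tau0 taund G0 mG suppG finG l s1 c0 e0 cP.
  rewrite powRM ?exprn_ge0 ?(ltW c0) ?(ltW C_gt0)//.
  have -> : (((C ^+ 3) ^+ l) `^ s = ((C ^+ 3) `^ s) ^+ l)%R.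
    have C3 : (0 <= C ^+ 3)%R by rewrite exprn_ge0// ltW.
    by rewrite -(powR_mulrn l C3) -(powR_mulrn l (powR_ge0 _ _)) -!powRrM mulrC.
  by rewrite mulrA.
have [c c0 cP] := sum_mul_inve_le s0 s1.
(* Positivity of [e] stands under the existential so that [choice] yields a total function of
   [e]. *)
have Kex e : exists K, (0 < e)%R -> (0 < K)%R /\ forall u v, (0 <= u <= v)%R ->
    (u `^ s)%:E <= (e * v `^ s)%:E + K%:E * (u%:E * ((v `^ (1 - s))%:E)^-1).
  have [e0|] := boolP (0 < e)%R; last by exists 0%R.
  by have [K K0 KP] := powR_young_inve s0 s1 e0; exists K.
have [K KP] := choice Kex.
exists (C ^+ 3)%R, (fun e => K e * c)%R; split; first by rewrite exprn_gt0.
move=> e e0; have [K0 youngP] := KP e e0; split; first by rewrite mulr_gt0.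
move=> n tau G tau0 taund G0 mG suppG finG I l.
have := energy_step_lt1 n a0 tau0 taund G0 mG suppG finG l s0 s1 c0 e0 K0 cP youngP.
by rewrite mulrA.
Qed.

(** * Truncation and passage to the limit *)

Section Truncation.
Hypothesis nu_box : forall N : nat, nu [set z | (mdist (point : X) (loc z) < N%:R)%R /\
  ((2 ^+ N)^-1 <= ht z < 2 ^+ N)%R] < +oo.

Let box (N : nat) : set Z := [set z | (mdist (point : X) (loc z) < N%:R)%R /\
  ((2 ^+ N)^-1 <= ht z < 2 ^+ N)%R].

Let slab (b c : R) : set Z := [set z | (b <= ht z < c)%R].

Let measurable_slab b c : measurable (slab b c).
Proof.
rewrite (_ : slab b c = ~` [set z | (ht z < b)%R] `&` [set z | (ht z < c)%R]).
  apply: measurableI; first apply: measurableC; exact: measurable_set_ltr.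
apply/seteqP; split=> z /=; first by move=> /andP[bz ->]; rewrite ltNge bz.
by move=> [/negP zb zc]; rewrite /slab/= zc andbT leNgt.
Qed.

Let measurable_box N : measurable (box N).
Proof.
rewrite (_ : box N = [set z | (mdist (point : X) (loc z) < N%:R)%R] `&`
    slab (2 ^+ N)^-1 (2 ^+ N)) //.
apply: measurableI => //; apply: measurable_set_ltr => //.
exact: (measurableT_comp (measurable_mdist point) measurable_loc).
Qed.

(** Bounded values on a box of finite measure make all cone integrals finite and supply the a priori
    growth bound. *)
Let trunc (G : Z -> \bar R) N := (fun z => mine (G z) N%:R%:E) \_ (box N).

Let sum_slabs (f : Z -> \bar R) (tau : nat -> R) m z :
  {homo tau : i j / (i <= j)%N >-> (i <= j)%R} ->
  \sum_(0 <= i < m) (f \_ (slab (tau i) (tau i.+1))) z =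
  (f \_ (slab (tau 0%N) (tau m))) z.
Proof.
move=> taund; have in_slab b c : (z \in slab b c) = (b <= ht z < c)%R.
  by apply/idP/idP; rewrite inE.
elim: m => [|m IHm].
  by rewrite big_geq// patchE in_slab; case: ifPn => // /andP[/le_lt_trans/[apply]]; rewrite ltxx.
rewrite big_nat_recr//= IHm !patchE !in_slab.
have t0m := taund 0%N m (leq0n m); have tmS := taund m m.+1 (leqnSn m).
have [tz|tz] := leP (tau m) (ht z).
  by rewrite andbF/= add0e (le_trans t0m tz).
by rewrite (lt_le_trans tz tmS) !andbT adde0.
Qed.

Section TruncationOf.
Variable G : Z -> \bar R.
Hypothesis G_ge0 : forall z, 0 <= G z.
Hypothesis measurable_G : measurable_fun setT G.

Let trunc_ge0 N z : 0 <= trunc G N z.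
Proof.
by rewrite /trunc patchE; case: ifP => // _; rewrite le_min G_ge0/= lee_fin ler0n.
Qed.

Let measurable_trunc N : measurable_fun setT (trunc G N).
Proof.
apply/(measurable_restrictT _ _).1 => //; apply: measurable_funTS.
exact: measurable_mine.
Qed.

Let trunc_le N z : trunc G N z <= G z.
Proof. by rewrite /trunc patchE; case: ifP => // _; rewrite ge_min lexx. Qed.

Let trunc_nd z : {homo (fun N => trunc G N z) : m n / (m <= n)%N >-> m <= n}.
Proof.
move=> m n mn; rewrite /trunc !patchE; case: ifPn => [|_]; last first.
  by case: ifP => // _; rewrite le_min G_ge0/= lee_fin ler0n.
have mnR : (m%:R <= n%:R :> R)%R by rewrite ler_nat.
have m2n : ((2 : R) ^+ m <= 2 ^+ n)%R by rewrite ler_weXn2l// ler1n.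
rewrite inE => -[zm /andP[mz zm']].
rewrite ifT.
  by rewrite le_min ge_min lexx/= ge_min lee_fin mnR orbT.
rewrite inE; split; first exact: lt_le_trans mnR.
rewrite (lt_le_trans zm' m2n) andbT (le_trans _ mz)//.
by rewrite lef_pV2 ?posrE ?exprn_gt0.
Qed.

(** A point of positive height lies in all boxes from some [N0] on, and there the cap [N] exceeds
    any given real. *)
Let trunc_sup z : (0 < ht z)%R ->
  G z <= ereal_sup (range (fun N => trunc G N z)).
Proof.
move=> z0; set u := fun N => trunc G N z.
pose N0 := maxn (Num.bound (mdist (point : X) (loc z)))
  (maxn (Num.bound (ht z)) (Num.bound (ht z)^-1%R)).
have boundP (r : R) N : (0 <= r)%R -> (Num.bound r <= N)%N -> (r < N%:R)%R.
  move=> r0 rN; have /lt_le_trans : (r < (Num.bound r)%:R)%R by exact: archi_boundP.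
  by apply; rewrite ler_nat.
have natX2 (N : nat) : (N%:R <= (2 : R) ^+ N)%R.
  by rewrite -natrX ler_nat ltnW// ltn_expl.
have inbox N : (N0 <= N)%N -> z \in box N.
  rewrite !geq_max => /and3P[N1 N2 N3]; rewrite inE; split.
    by apply: boundP => //; exact: mdist_ge0.
  apply/andP; split; last by rewrite (lt_le_trans (boundP _ _ _ N2))// ltW.
  rewrite invf_ple ?posrE ?exprn_gt0//.
  by rewrite ltW// (lt_le_trans (boundP _ _ _ N3))// invr_ge0 ltW.
have le_sup N : (N0 <= N)%N -> mine (G z) N%:R%:E <= ereal_sup (range u).
  by move=> /inbox zN; apply: ereal_sup_ubound; exists N => //; rewrite /u /trunc patchE zN.
have := G_ge0 z; case E : (G z) => [r| |//] r0; last first.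
  rewrite leye_eq; apply/eqP/eqyP => A A0; have := le_sup _ (leq_maxl N0 (Num.bound A)).
  rewrite E min_r ?leey//; apply: le_trans; rewrite lee_fin ltW//.
  by rewrite boundP ?(ltW A0)// leq_maxr.
have := le_sup _ (leq_maxl N0 (Num.bound r)).
by rewrite E min_l// lee_fin ltW// boundP ?leq_maxr.
Qed.

Let cone_int_trunc_le r N x : cone_int r (trunc G N) x <=
  N%:R%:E * nu (box N).
Proof.
rewrite /cone_int -integral_cst// [leLHS]integral_mkcond [leRHS]integral_mkcond.
apply: ge0_le_integral => //.
- by move=> z _; rewrite patchE; case: ifP.
- apply/(measurable_restrictT _ _).1; first exact: measurable_zcone.
  exact: measurable_funTS.
- by apply/(measurable_restrictT _ _).1.
move=> z _; rewrite /trunc !patchE.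
by case: ifP => _; case: ifP => _; rewrite ?ge_min ?lee_fin ?lexx ?orbT.
Qed.

Let cone_int_trunc_out r N x : (0 <= r)%R ->
  (N%:R + r * 2 ^+ N <= mdist (point : X) x)%R -> cone_int r (trunc G N) x = 0.
Proof.
move=> r0 Nx; apply: integral0_eq => z [z0 xz].
rewrite /trunc patchE; case: ifPn => //; rewrite inE => -[zN /andP[_ zN']].
move: Nx; rewrite leNgt => /negP; case.
rewrite (le_lt_trans (metric_triangle _ (loc z) _))// ltrD// metric_sym.
by rewrite (lt_le_trans xz)// ler_wpM2l// ltW.
Qed.

(** The cone integral is at most [F] and vanishes for vertices outside the ball of radius [L 5^l],
    because [N + a 5^l 2^N <= L 5^l]. Only [M0] depends on the truncation; the rate [C^3] comes from
    doubling. *)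
Let cone_int_trunc_bound s a N : (0 < s)%R -> (0 < a)%R ->
  exists2 M0, (0 <= M0)%R & forall l,
    \int[mu]_x (cone_int (a * 5 ^+ l) (trunc G N) x `^ s) <=
    (M0 * (C ^+ 3) ^+ l)%:E.
Proof.
move=> s0 a0; pose F := N%:R%:E * nu (box N); pose L := (N%:R + a * 2 ^+ N)%R.
have L0 : (0 < L)%R by rewrite ltr_wpDl// mulr_gt0// exprn_gt0.
have Ff : F \is a fin_num.
  rewrite fin_numM// ge0_fin_numE ?measure_ge0//; exact: nu_box.
have Vf := volume_fin_num mu_nondegenerate point L0.
have F0 : 0 <= F by rewrite mule_ge0 ?lee_fin.
have Fs0 : 0 <= F `^ s by exact: poweR_ge0.
have Fsf : F `^ s \is a fin_num by exact: fin_num_poweR.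
exists (fine (F `^ s * volume mu point L)).
  by rewrite fine_ge0// mule_ge0// measure_ge0.
move=> l; rewrite EFinM fineK ?fin_numM//.
have mH := measurable_cone_int (a * 5 ^+ l) (trunc_ge0 N) (measurable_trunc N).
(* The factor [1] is the height [t] in [volume_pow5_le]. *)
have mB := measurable_ball_borel (point : X) (L * 5 ^+ l * 1)%R.
apply: (@le_trans _ _ (\int[mu]_(x in ball (point : X) (L * 5 ^+ l * 1)%R) cst (F `^ s) x)).
  rewrite [leRHS]integral_mkcond; apply: ge0_le_integral => //.
  - by move=> x _; exact: poweR_ge0.
  - exact: (measurableT_comp (measurable_poweR s) mH).
  - by apply/(measurable_restrictT _ _).1.
  move=> x _; rewrite patchE; case: ifPn => [_|].
    apply: gt0_ler_poweR; [exact: ltW| | |exact: cone_int_trunc_le].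
    - by rewrite in_itv/= leey cone_int_ge0.
    - by rewrite in_itv/= leey F0.
  rewrite notin_setE ballEmdist/= => /negP; rewrite -leNgt => Lx.
  rewrite cone_int_trunc_out ?poweR0r ?gt_eqF//.
    by rewrite mulr_ge0 ?exprn_ge0 ?(ltW a0).
  rewrite (le_trans _ Lx)// mulr1 mulrDl mulrAC lerD2r.
  by rewrite ler_peMr// exprn_ege1//; lra.
rewrite integral_cst// -muleA lee_wpmul2l// muleC -[L in leRHS]mulr1.
exact: volume_pow5_le.
Qed.

Lemma trunc_aperture a s k N M : (0 < a)%R -> (0 < s)%R ->
  (forall n (tau : nat -> R) (F : nat -> Z -> \bar R) M0,
    (forall i, 0 < tau i)%R ->
    {homo tau : i j / (i <= j)%N >-> (i <= j)%R} ->
    (forall i z, 0 <= F i z) -> (forall i, measurable_fun setT (F i)) ->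
    (forall i z, F i z != 0 -> (tau i <= ht z < 2 * tau i)%R) ->
    (forall l i x, cone_int (a * 5 ^+ l) (F i) x \is a fin_num) ->
    let I l := \int[mu]_x
      ((\sum_(0 <= i < n) cone_int (a * 5 ^+ l) (F i) x) `^ s) in
    (0 <= M0)%R -> (forall l, I l <= (M0 * (C ^+ 3) ^+ l)%:E) ->
    I k <= M%:E * I 0%N) ->
  \int[mu]_x (cone_int (a * 5 ^+ k) (trunc G N) x `^ s) <=
  M%:E * \int[mu]_x (cone_int a (trunc G N) x `^ s).
Proof.
(* The first [2 N] of these dyadic slabs tile the heights [[2^-N, 2^N)] of the box exactly. *)
move=> a0 s0; pose tau i := ((2 : R) ^+ i / 2 ^+ N)%R.
pose F i := trunc G N \_ (slab (tau i) (tau i.+1)).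
have tau0 i : (0 < tau i)%R by rewrite divr_gt0 ?exprn_gt0.
have tauS i : tau i.+1 = (2 * tau i)%R by rewrite /tau exprS mulrA.
have taund : {homo tau : i j / (i <= j)%N >-> (i <= j)%R}.
  by move=> i j ij; rewrite ler_wpM2r ?invr_ge0 ?exprn_ge0// ler_weXn2l// ler1n.
have F0 i z : 0 <= F i z by rewrite /F patchE; case: ifP.
have mF i : measurable_fun setT (F i).
  by apply/(measurable_restrictT _ _).1 => //; exact: measurable_funTS.
have FE z : \sum_(0 <= i < (N + N)%N) F i z = trunc G N z.
  rewrite /F sum_slabs// patchE; case: ifPn => //.
  rewrite notin_setE /trunc patchE; case: ifPn => //.
  rewrite inE => -[_ zN]; case => /=; move: zN.
  by rewrite /tau exprD mulfK ?expr0 ?div1r// gt_eqF// exprn_gt0.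
have sumE r x : \sum_(0 <= i < (N + N)%N) cone_int r (F i) x =
    cone_int r (trunc G N) x.
  rewrite -cone_int_sum//; congr (cone_int r _ x).
  by apply/funext => z; rewrite FE.
have [M0 M00 M0P] := @cone_int_trunc_bound s a N s0 a0.
move=> /(_ (N + N)%N tau F M0 tau0 taund F0 mF).
have suppF i z : F i z != 0 -> (tau i <= ht z < 2 * tau i)%R.
  by rewrite /F patchE -tauS; case: ifPn; rewrite ?eqxx// inE.
move=> /(_ suppF); set I := fun l => integral _ _ _.
have IE l : I l = \int[mu]_x (cone_int (a * 5 ^+ l) (trunc G N) x `^ s).
  by apply: eq_integral => x _; rewrite sumE.
rewrite /= !IE expr0 mulr1; apply => //; last by move=> l; rewrite IE.
move=> l i x; rewrite ge0_fin_numE ?cone_int_ge0//.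
apply: (@le_lt_trans _ _ (cone_int (a * 5 ^+ l) (trunc G N) x)).
  apply: ge0_le_integral => //; first exact: measurable_zcone.
  - exact: measurable_funTS.
  - exact: measurable_funTS.
  - by move=> z _; rewrite /F patchE; case: ifP.
rewrite (le_lt_trans (cone_int_trunc_le _ _ _))// ltey_eq fin_numM//.
rewrite ge0_fin_numE ?measure_ge0//; exact: nu_box.
Qed.

(** Monotone convergence is used twice: over [X], and inside each cone. *)
Lemma integral_pow_le s r c : (0 < s)%R -> (0 < r)%R -> 
  (forall N, \int[mu]_x (cone_int r (trunc G N) x `^ s) <= c) ->
  \int[mu]_x (cone_int r G x `^ s) <= c.
Proof.
move=> s0 r0; have mH := @measurable_cone_int r.
have H0 N x : 0 <= cone_int r (trunc G N) x by exact: cone_int_ge0.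
have Hitv N x : cone_int r (trunc G N) x \in `[0, +oo] by rewrite in_itv/= leey H0.
have mz x := measurable_zcone r x.
apply: integral_le_of_sup => //.
- by move=> N; apply: (measurableT_comp (measurable_poweR s)); exact: mH.
- by move=> N x _; exact: poweR_ge0.
- move=> x _ m n mn; apply: gt0_ler_poweR => //; first exact: ltW.
  apply: ge0_le_integral => //.
  + exact: measurable_funTS.
  + exact: measurable_funTS.
  + by move=> z _; exact: trunc_nd.
- by apply: (measurableT_comp (measurable_poweR s)); exact: mH.
- by move=> x _; exact: poweR_ge0.
move=> x _; set L := ereal_sup _.
have L0 : 0 <= L.
  by apply: (le_trans (poweR_ge0 (cone_int r (trunc G 0) x) s)); apply: ereal_sup_ubound; exists 0%N.
(* Writing [L] as a power removes the exponent, so that the inner limit concerns the cone integrals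
   themselves. *)
have LL : (L `^ s^-1) `^ s = L.
  by rewrite -poweRrM mulVf ?gt_eqF// poweRe1.
rewrite -LL; apply: gt0_ler_poweR; first exact: ltW.
- by rewrite in_itv/= leey cone_int_ge0.
- by rewrite in_itv/= leey poweR_ge0.
apply: (@integral_le_of_sup _ _ _ nu _ _ (trunc G)) => //.
- by move=> N; exact: measurable_funTS.
- exact: measurable_funTS.
- by move=> z [z0 _]; exact: trunc_sup.
move=> N; rewrite -/(cone_int r (trunc G N) x).
have <- : (cone_int r (trunc G N) x `^ s) `^ s^-1 = cone_int r (trunc G N) x.
  by rewrite -poweRrM mulfV ?gt_eqF// poweRe1.
apply: gt0_ler_poweR; rewrite ?invr_ge0 ?(ltW s0)//.
- by rewrite in_itv/= leey poweR_ge0.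
- by rewrite in_itv/= leey L0.
- by apply: ereal_sup_ubound; exists N.
Qed.

End TruncationOf.

(** Change of aperture for a fixed density: [M] is uniform in the truncation level, and on the right
    truncations are dominated by [G]. *)
Lemma cone_int_aperture_le a s k : (0 < a)%R -> (0 < s)%R ->
  exists2 M, (0 < M)%R & forall G : Z -> \bar R,
    (forall z, 0 <= G z) -> measurable_fun setT G ->
    \int[mu]_x (cone_int (a * 5 ^+ k) G x `^ s) <=
    M%:E * \int[mu]_x (cone_int a G x `^ s).
Proof.
move=> a0 s0; have [M M0 MP] := slab_aperture_le k a0 s0.
exists M => // G G0 mG; apply: integral_pow_le => //.
  by rewrite mulr_gt0// exprn_gt0.
move=> N; apply: (le_trans (trunc_aperture G0 mG N a0 s0 MP)).
rewrite lee_wpmul2l ?lee_fin ?(ltW M0)//.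
have pos (H : Z -> \bar R) x : (forall z, 0 <= H z) -> cone_int a H x \in `[0, +oo].
  by move=> H0; rewrite in_itv/= leey cone_int_ge0.
have trunc0 z : 0 <= trunc G N z.
  by rewrite /trunc patchE; case: ifP => // _; rewrite le_min G0/= lee_fin ler0n.
have mT : measurable_fun setT (trunc G N).
  apply/(measurable_restrictT _ _).1 => //; apply: measurable_funTS.
  exact: measurable_mine.
apply: ge0_le_integral => //.
- by move=> x _; exact: poweR_ge0.
- by apply: (measurableT_comp (measurable_poweR s)); exact: measurable_cone_int.
- by apply: (measurableT_comp (measurable_poweR s)); exact: measurable_cone_int.
move=> x _; apply: gt0_ler_poweR; [exact: ltW|exact: pos|exact: pos|].
apply: ge0_le_integral => //; first exact: measurable_zcone.
- exact: measurable_funTS.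
- exact: measurable_funTS.
by move=> z _; rewrite /trunc patchE; case: ifP => // _; rewrite ge_min lexx.
Qed.

End Truncation.

End ConeIntegral.

(** * Tent spaces *)

Section ProductSigmaFinite.
Context d1 d2 (T1 : measurableType d1) (T2 : measurableType d2) (R : realType).
Variable m1 : {sigma_finite_measure set T1 -> \bar R}.
Variable m2 : {sigma_finite_measure set T2 -> \bar R}.

Lemma product_measure_sigma_finite : sigma_finite setT (m1 \x m2)%E.
Proof.
have /sigma_finiteP[F [TF ndF Foo]] := sigma_finiteT m1.
have /sigma_finiteP[G [TG ndG Goo]] := sigma_finiteT m2.
exists (fun n => F n `*` G n).
  apply/esym; rewrite -subTset => -[x y] _.
  have : setT x by []. rewrite TF => -[n _ Fx].
  have : setT y by []. rewrite TG => -[k _ Gy].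
  exists (maxn n k) => //; split => /=.
    by move: x Fx; exact/subsetPset/ndF/leq_maxl.
  by move: y Gy; exact/subsetPset/ndG/leq_maxr.
move=> k; have [mF Fk] := Foo k; have [mG Gk] := Goo k.
split; first exact: measurableX.
by rewrite product_measure1E// lte_mul_pinfty// ge0_fin_numE.
Qed.

(* The library's own sigma-finite instance on [m1 \x m2] is not inferred. *)
Definition product_sigma_finite : set (T1 * T2)%type -> \bar R := (m1 \x m2)%E.
HB.instance Definition _ := Measure.copy product_sigma_finite (m1 \x m2)%E.
HB.instance Definition _ := Measure_isSigmaFinite.Build _ _ _
  product_sigma_finite product_measure_sigma_finite.

End ProductSigmaFinite.

Section BallMeasure.
Context {R : realType} {X : pmetricType R} {mu : {measure set (borel X) -> \bar R}}.

(** A name for [mu] that carries the nondegeneracy proof, so that the sigma-finite structure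
    depending on this proof can be attached to it. *)
Definition ball_measure of balls_nondegenerate mu : set (borel X) -> \bar R := mu.

Hypothesis mu_nondegenerate : balls_nondegenerate mu.

HB.instance Definition _ := Measure.copy (ball_measure mu_nondegenerate) mu.
HB.instance Definition _ := Measure_isSigmaFinite.Build _ _ _
  (ball_measure mu_nondegenerate) (sigma_finite_balls mu_nondegenerate).

End BallMeasure.

Lemma measurable_normc (R : realType) :
  measurable_fun setT (@ComplexField.Normc.normc R : borel (R[i]^o) -> R).
Proof.
apply: (measurability _ (RGenInftyO.measurableE R)) => _ [_ [r ->] <-].
rewrite setTI; apply: sub_sigma_algebra.
rewrite /= openE => z /=; rewrite in_itv/= => zr.
(* Balls of [R[i]^o] have complex radii, hence the embedding. *)
apply/nbhs_ballP; exists ((r - ComplexField.Normc.normc z)%:C)%C => /=.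
  by rewrite ltcR subr_gt0.
move=> w; rewrite /ball/= => zw; rewrite in_itv/=.
move: zw; rewrite {1}/Num.norm/= ltcR => zw.
have := le_normcD (z : Rcomplex R) (w - z).
rewrite addrC subrK => /le_lt_trans; apply.
by rewrite -(normcN (w - z)) opprB -ltrBrDl.
Qed.

(** * From cone integrals to tent norms *)

Section TentSpace.
Context {R : realType} {X : pmetricType R}.
Variable mu : {measure set (borel X) -> \bar R}.
Hypothesis mu_nondegenerate : balls_nondegenerate mu.
Variable C : R.
Hypothesis C_gt0 : 0 < C.
Hypothesis volume_double : forall x r, 0 < r ->
  (volume mu x (2 * r)%R <= C%:E * volume mu x r)%E.

Local Open Scope ereal_scope.

Lemma volume_comparable (a b : R) : (0 < a)%R -> (0 < b)%R ->
  exists2 K : R, (0 < K)%R & forall y t, (0 < t)%R ->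
    volume mu y (b * t)%R <= K%:E * volume mu y (a * t)%R.
Proof.
move=> a0 b0; pose n := Num.bound (b / a); exists (C ^+ n)%R.
  by rewrite exprn_gt0.
move=> y t t0.
apply: le_trans (volume_iter_double C_gt0 volume_double n y (mulr_gt0 a0 t0)).
apply: le_volume; rewrite mdistxx add0r mulrA ler_wpM2r ?(ltW t0)//.
rewrite -ler_pdivrMr// ltW//.
have /lt_le_trans : (b / a < n%:R)%R.
  by apply: archi_boundP; rewrite divr_ge0 ?(ltW a0) ?(ltW b0).
by apply; rewrite -natrX ler_nat ltnW// ltn_expl.
Qed.

Let muS : {sigma_finite_measure set (borel X) -> \bar R} :=
  ball_measure mu_nondegenerate.
Let Z : measurableType _ := (borel X * measurableTypeR R)%type.
Let nu : {sigma_finite_measure set Z -> \bar R} :=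
  product_sigma_finite muS (@lebesgue_measure R).
Let loc : Z -> X := fst.
Let ht : Z -> R := snd.

Let measurable_loc : measurable_fun setT (loc : Z -> borel X).
Proof. exact: measurable_fst. Qed.

Let measurable_ht : measurable_fun setT ht.
Proof. exact: measurable_snd. Qed.

Let nu_box (N : nat) : nu [set z | (mdist (point : X) (loc z) < N%:R)%R /\
  ((2 ^+ N)^-1 <= ht z < 2 ^+ N)%R] < +oo.
Proof.
pose I := `[((2 : R) ^+ N)^-1%R, (2 ^+ N)%R[%classic.
(* Radius [N + 1] rather than [N]: nondegeneracy gives finite volume only for positive radii, and
   [N] may be [0]. *)
have mB := measurable_ball_borel (point : X) N.+1%:R.
have mI : measurable (I : set (measurableTypeR R)) by exact: measurable_itv.
apply: (@le_lt_trans _ _ (nu (ball (point : X) N.+1%:R `*` I))).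
  apply: le_measure; rewrite ?inE.
  - rewrite (_ : [set z | _] = [set z : Z | (mdist (point : X) (loc z) < N%:R)%R] `&`
        (setT `*` I)); last first.
      apply/seteqP; split=> z /=.
        by move=> [zN zI]; split=> //; split=> //; rewrite /I /= in_itv.
      by move=> [zN [_]]; rewrite /I /= in_itv.
    apply: measurableI; last exact: measurableX.
    apply: measurable_set_ltr => //.
    exact: (measurableT_comp (measurable_mdist point) measurable_loc).
  - exact: measurableX.
  - move=> z [zN zI]; split; last by rewrite /I /= in_itv.
    by apply/ballP; rewrite (lt_trans zN)// ltr_nat.
rewrite /nu /= /product_sigma_finite product_measure1E//.
rewrite lte_mul_pinfty ?measure_ge0//.
- by apply: volume_fin_num => //; exact: mu_nondegenerate.
- have : lebesgue_measure (I : set R) < +oo; last by [].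
  by rewrite /I lebesgue_measure_itv/=; case: ifPn => _; rewrite ?ltry// -EFinB ltry.
Qed.

Let H := cone_int nu loc ht.

(** Extension by [0] makes this nonnegative and measurable on all of [Z], whatever [f] is off the
    upper half-space. *)
Let density q alpha (f : X * R -> R[i]) : Z -> \bar R :=
  (fun z => (ComplexField.Normc.normc (f z) `^ q
        / fine (volume mu z.1 (alpha * z.2)) / z.2)%:E) \_ (@upper_half R X).

Let measurable_upper_half : measurable (@upper_half R X : set Z).
Proof. exact: measurable_set_ltr. Qed.

Let density_ge0 q alpha f z : 0 <= density q alpha f z.
Proof.
rewrite /density patchE; case: ifPn => //; rewrite inE => z0.
by rewrite lee_fin !divr_ge0 ?powR_ge0 ?fine_ge0 ?measure_ge0// ltW.
Qed.

Let measurable_density q alpha f : (0 < alpha)%R ->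
  measurable_on_upper_half f -> measurable_fun setT (density q alpha f).
Proof.
move=> a0 mf; apply/(measurable_restrictT _ _).1 => //.
apply/measurable_EFinP.
(* On the upper half-space this is the volume in the density, and its measurability comes from
   Tonelli. *)
pose V z := muS (cone_base loc ht alpha z).
have mV : measurable_fun setT V.
  have := @measurable_mul_base_int _ _ muS mu_nondegenerate C C_gt0 volume_double _ _
    loc ht measurable_loc measurable_ht alpha (cst 1) (cst 1) (fun=> lee01)
    (measurable_cst _) (fun=> lee01) (measurable_cst _).
  congr measurable_fun; apply/funext => z; rewrite mul1e integral_cst ?mul1e//.
  exact: (@measurable_cone_base _ _ muS mu_nondegenerate C).
pose W (z : Z) : R :=
  (ComplexField.Normc.normc (f z) `^ q * fine (V z) `^ (-1) * z.2 `^ (-1))%R.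
have mW : measurable_fun (@upper_half R X : set Z) W.
  apply: measurable_funM; last first.
    apply: measurable_funTS.
    exact: (measurableT_comp (measurable_powR _) measurable_ht).
  apply: measurable_funM; last first.
    apply: measurable_funTS.
    apply: (measurableT_comp (measurable_powR _)).
    exact: (measurableT_comp (fine_measurable measurableT) mV).
  apply: (measurableT_comp (measurable_powR _)).
  exact: (measurableT_comp (@measurable_normc R) mf).
apply: eq_measurable_fun mW => z; rewrite inE => z0.
rewrite /W !powR_inv1 ?(ltW z0) ?fine_ge0 ?measure_ge0//.
by rewrite /V cone_baseE.
Qed.

Let tent_normE p q alpha f : (0 < p)%R -> (0 < q)%R ->
  tent_norm mu p q alpha f =
  (\int[mu]_x (H alpha (density q alpha f) x `^ (p / q))) `^ p^-1.
Proof.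
move=> p0 q0; rewrite /tent_norm unlock; congr (_ `^ _).
apply: eq_integral => x _; rewrite gee0_abs ?poweR_ge0//.
rewrite /area_functional -poweRrM mulrC; congr (_ `^ _).
apply: eq_integral => z; rewrite inE => -[z0 _].
by rewrite /density patchE mem_set.
Qed.

(** The aperture enters twice: through the cone, handled by [cone_int_aperture_le] with
    [beta <= alpha 5^k], and through the volume in the density, handled by doubling. *)
Lemma tent_norm_le p q alpha beta : (0 < alpha)%R -> (0 < beta)%R ->
  (0 < p)%R -> (0 < q)%R ->
  exists2 M, (0 < M)%R & forall f : X * R -> R[i], measurable_on_upper_half f ->
    tent_norm mu p q beta f <= M%:E * tent_norm mu p q alpha f.
Proof.
move=> a0 b0 p0 q0; pose s := (p / q)%R; have s0 : (0 < s)%R by rewrite divr_gt0.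
have [K K0 VK] := volume_comparable b0 a0.
pose k := Num.bound (beta / alpha).
have bk : (beta <= alpha * 5 ^+ k)%R.
  rewrite mulrC -ler_pdivrMr// ltW//.
  have /lt_le_trans : (beta / alpha < k%:R)%R.
    by apply: archi_boundP; rewrite divr_ge0 ?(ltW a0) ?(ltW b0).
  by apply; rewrite -natrX ler_nat ltnW// ltn_expl.
have [M M0 MP] := cone_int_aperture_le (mu := muS) mu_nondegenerate C_gt0
  volume_double measurable_loc measurable_ht nu_box k a0 s0.
(* [K^s] pays for the change of density, [M] for the change of cone, and [1 / p] is the outer
   exponent of the norm. *)
exists ((K `^ s * M) `^ p^-1)%R; first by apply: powR_gt0; rewrite mulr_gt0 ?powR_gt0.
move=> f mf; rewrite !tent_normE// -poweR_EFin.
have mda := measurable_density q a0 mf; have mdb := measurable_density q b0 mf.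
have mz r x : measurable (zcone loc ht r x) by exact: (@measurable_zcone _ _ muS mu_nondegenerate C).
have H0 r a x : 0 <= H r (density q a f) x by exact: cone_int_ge0.
have mH r a : (0 < a)%R -> measurable_fun setT (H r (density q a f)).
  move=> a_gt0; apply: (@measurable_cone_int _ _ muS mu_nondegenerate C) => //.
  exact: measurable_density.
have itv0 r a x : H r (density q a f) x \in `[0, +oo] by rewrite in_itv/= leey H0.
have mHs r a : (0 < a)%R ->
    measurable_fun setT (fun x => H r (density q a f) x `^ s).
  by move=> a_gt0; apply: (measurableT_comp (measurable_poweR s)); exact: mH.
have dens z : density q beta f z <= K%:E * density q alpha f z.
  rewrite /density !patchE; case: ifPn => [|_]; last by rewrite mule0.
  rewrite inE => z0; rewrite -EFinM lee_fin.
  have za : (0 < alpha * z.2)%R by rewrite mulr_gt0.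
  have zb : (0 < beta * z.2)%R by rewrite mulr_gt0.
  have Va : (0 < fine (volume mu z.1 (alpha * z.2)))%R.
    by rewrite fine_gt0// mu_nondegenerate.
  have Vb : (0 < fine (volume mu z.1 (beta * z.2)))%R.
    by rewrite fine_gt0// mu_nondegenerate.
  rewrite mulrA ler_wpM2r ?invr_ge0 ?(ltW z0)// mulrCA ler_wpM2l ?powR_ge0//.
  rewrite ler_pdivlMr// mulrC ler_pdivrMr// -lee_fin EFinM !fineK ?volume_fin_num//.
  exact: VK.
have Hle x : H beta (density q beta f) x <=
    K%:E * H (alpha * 5 ^+ k) (density q alpha f) x.
  apply: (@le_trans _ _ (\int[nu]_(z in zcone loc ht beta x)
      (K%:E * density q alpha f z))).
    apply: ge0_le_integral => //; first exact: measurable_funTS.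
    by apply: measurable_funeM; exact: measurable_funTS.
  rewrite ge0_integralZl ?lee_fin ?(ltW K0)//; last exact: measurable_funTS.
  rewrite lee_wpmul2l ?lee_fin ?(ltW K0)//.
  apply: ge0_subset_integral => //; first exact: measurable_funTS.
  by move=> z [z0 xz]; split=> //; rewrite (lt_le_trans xz)// ler_wpM2r// ltW.
have I0 a : 0 <= \int[mu]_x (H a (density q a f) x `^ s).
  by apply: integral_ge0 => x _; exact: poweR_ge0.
rewrite -poweRM ?lee_fin ?mulr_ge0 ?powR_ge0 ?(ltW M0)//.
apply: gt0_ler_poweR; first by rewrite invr_ge0 ltW.
- by rewrite in_itv/= leey I0.
- by rewrite in_itv/= leey mule_ge0 ?lee_fin ?mulr_ge0 ?powR_ge0 ?(ltW M0).
apply: (@le_trans _ _ (\int[mu]_x ((K `^ s)%:E *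
    H (alpha * 5 ^+ k) (density q alpha f) x `^ s))).
  apply: ge0_le_integral => //.
  - by move=> x _; exact: poweR_ge0.
  - exact: mHs.
  - by apply: measurable_funeM; exact: mHs.
  move=> x _; rewrite -poweR_EFin -poweRM ?lee_fin ?(ltW K0)//.
  apply: gt0_ler_poweR => //; first exact: ltW.
  by rewrite in_itv/= leey mule_ge0// lee_fin ltW.
rewrite ge0_integralZl ?lee_fin ?powR_ge0//; last 2 first.
- exact: mHs.
- by move=> x _; exact: poweR_ge0.
by rewrite EFinM -muleA lee_wpmul2l ?lee_fin ?powR_ge0// MP.
Qed.

End TentSpace.

Theorem proposition3p21 (R : realType) (X : pmetricType R)
    (mu : {measure set (borel X) -> \bar R})
    (mu_nondegenerate : balls_nondegenerate mu) (mu_doubling : doubling mu)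
    (alpha beta p q : R)
    (alpha_gt0 : 0 < alpha) (beta_gt0 : 0 < beta)
    (p_gt0 : 0 < p) (q_gt0 : 0 < q) :
  equivalent_norms (@measurable_on_upper_half R X)
    (tent_norm mu p q alpha) (tent_norm mu p q beta).
Proof.
have [C C0 VC] := mu_doubling.
have [C1 C10 H1] :=
  tent_norm_le mu_nondegenerate C0 VC beta_gt0 alpha_gt0 p_gt0 q_gt0.
have [C2 C20 H2] :=
  tent_norm_le mu_nondegenerate C0 VC alpha_gt0 beta_gt0 p_gt0 q_gt0.
by exists C1, C2; split=> // f mf; split; [exact: H1|exact: H2].
Qed.
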